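(* Assume that the system $g(p,x)\in C$ enjoys Robinson stability at $(\bar p,\bar x)$, and that the following condition holds: (C1) for every $0\ne u\in{\cal K}_{\Gamma(\bar p)}(\bar x,-f(\bar z))$, every $\lambda\in\bar\Lambda$, and every $\hat\lambda\in\Lambda(\bar z,\nabla g(\bar z)^*\lambda;(0,u))$, either $\langle{\cal F}_{\hat\lambda}u,u\rangle>0$ or $\langle{\cal F}_{\hat\lambda}u,\widetilde u\rangle<0$ for some $\widetilde u\in{\cal K}_{\Gamma(\bar p)}(\bar x,-f(\bar z))$. Then there are $\ell>0$ and neighborhoods $U$ of $\bar x$ and $Q$ of $\bar p$ such that $$S(p)\cap U\subset\{\bar x\}+\ell\Big(\|p-\bar p\|+\sqrt{{\rm dist}(p-\bar p;{\cal P})}\Big){\cal B}_X\quad\text{for all } p\in Q.$$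
   Context: Notation: $X=\mathbb R^n$, $P=\mathbb R^m$, $Y=\mathbb R^l$, $Z:=P\times X$, and $E$ is finite-dimensional. Dual spaces are distinguished from primal ones, and $A^*$ is the adjoint of a linear map $A$, and $\operatorname{rge}A$ its range. For a closed convex cone $K$, $K^*:=\{\mu:\langle\mu,y\rangle\le0\ \forall y\in K\}$ and $\operatorname{lin}K:=K\cap(-K)$. For a closed set $\Omega$ and $\bar z\in\Omega$: the tangent cone is $T_\Omega(\bar z):=\{w:\exists\, t_k\downarrow0,\ w_k\to w \text{ with } \bar z+t_kw_k\in\Omega\}$; the regular normal cone is $N_\Omega(\bar z):=\{z^*:\limsup_{z\to\bar z,\,z\in\Omega}\langle z^*,z-\bar z\rangle/\|z-\bar z\|\le0\}$; and the critical cone is ${\cal K}_\Omega(\bar z,z^* ):=T_\Omega(\bar z)\cap\{z^*\}^\perp$. ${\cal B}_X$ is the closed unit ball. Setting: $g\colon P\times X\to Y$ is $C^2$ around $\bar z=(\bar p,\bar x)$. The set $C\subset Y$ is closed and $C^2$-cone reducible at $g(\bar z)$ to a closed convex cone $K\subset E$: there exist a neighborhood $V$ of $g(\bar z)$ and a $C^2$ map $h\colon V\to E$ with $h(g(\bar z))=0$, $\nabla h(g(\bar z))$ surjective, and $C\cap V=\{y\in V:h(y)\in K\}$. Set $\Gamma(p):=\{x:g(p,x)\in C\}$ and $G:=h\circ g$ near $\bar z$. The map $f\colon P\times X\to X^*$ is $C^1$ around $\bar z$, and $S(p):=\{x:0\in f(p,x)+N_{\Gamma(p)}(x)\}$ with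 $\bar x\in S(\bar p)$. Robinson stability of $g(p,x)\in C$ at $(\bar p,\bar x)$: there are $\kappa\ge0$ and neighborhoods $W$ of $\bar p$ and $U$ of $\bar x$ with ${\rm dist}(x;\Gamma(p))\le\kappa\,{\rm dist}(g(p,x);C)$ on $W\times U$. ${\cal P}:=\{q\in P:\nabla_pG(\bar z)q\in\operatorname{rge}\nabla_xG(\bar z)+\operatorname{lin}K\}$. Multipliers: for $\lambda\in N_C(g(\bar z))$, $(\nabla h(g(\bar z))^* )^{-1}\lambda$ denotes the unique $\mu\in E^*$ with $\nabla h(g(\bar z))^*\mu=\lambda$. For $z^*\in Z^*$, set $\Lambda(\bar z,z^* ):=\{\lambda\in N_C(g(\bar z)):\nabla g(\bar z)^*\lambda=z^*\}$, and for $v\in Z$, $$\Lambda(\bar z,z^*;v):=\arg\max_{\lambda\in\Lambda(\bar z,z^* )}\Big(\langle\lambda,\nabla^2g(\bar z)(v,v)\rangle+\nabla^2\langle(\nabla h(g(\bar z))^* )^{-1}\lambda,h(\cdot)\rangle(g(\bar z))\big(\nabla g(\bar z)v,\nabla g(\bar z)v\big)\Big).$$ Further, $\bar\Lambda:=\{\lambda\in N_C(g(\bar z)):f(\bar z)+\nabla_xg(\bar z)^*\lambda=0\}$. For $\lambda\in N_C(g(\bar z))$, define ${\cal H}^x_\lambda u:=\nabla_xg(\bar z)^*\nabla^2\langle(\nabla h(g(\bar z))^* )^{-1}\lambda,h(\cdot)\rangle(g(\bar z))\nabla_xg(\bar z)u$ and ${\cal F}_\lambda u:=\nabla_xf(\bar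 z)u+\nabla^2_x\langle\lambda,g(\cdot)\rangle(\bar z)u+{\cal H}^x_\lambda u$ for $u\in X$, where $\nabla^2_x\langle\lambda,g(\cdot)\rangle(\bar z)$ is the partial Hessian in $x$ of $(p,x)\mapsto\langle\lambda,g(p,x)\rangle$. *)

(* Defs.v *)
From Stdlib Require Import Reals Lra ClassicalEpsilon.
From Stdlib Require Fin.
Open Scope R_scope.

Definition V (n : nat) := Fin.t n -> R.

Fixpoint fsum (n : nat) : (Fin.t n -> R) -> R :=
  match n return (Fin.t n -> R) -> R with
  | O => fun _ => 0
  | S k => fun x => x Fin.F1 + fsum k (fun i => x (Fin.FS i))
  end.

Class Euc (T : Type) := {
  ezero : T;
  eadd : T -> T -> T;
  escal : R -> T -> T;
  einner : T -> T -> R }.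
#[global] Hint Mode Euc ! : typeclass_instances.

#[global] Instance Euc_V (n : nat) : Euc (V n) := {
  ezero := fun _ => 0;
  eadd := fun x y i => x i + y i;
  escal := fun t x i => t * x i;
  einner := fun x y => fsum n (fun i => x i * y i) }.

#[global] Instance Euc_R : Euc R := {
  ezero := 0; eadd := Rplus; escal := Rmult; einner := Rmult }.

#[global] Instance Euc_prod (T U : Type) (HT : Euc T) (HU : Euc U) : Euc (T * U) := {
  ezero := (ezero, ezero);
  eadd := fun a b => (eadd (fst a) (fst b), eadd (snd a) (snd b));
  escal := fun t a => (escal t (fst a), escal t (snd a));
  einner := fun a b => einner (fst a) (fst b) + einner (snd a) (snd b) }.

Definition vsub {T} `{Euc T} (x y : T) : T := eadd x (escal (-1) y).
Definition enorm {T} `{Euc T} (x : T) : R := sqrt (einner x x).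

Definition ebasis (n : nat) (i : Fin.t n) : V n :=
  fun j => if Fin.eq_dec i j then 1 else 0.

(* adjoint A^* : U -> R^a of a linear map A : R^a -> U (duals identified
   with the spaces via the inner product): <A^* y, e_i> = <y, A e_i>. *)
Definition adj {a : nat} {U} `{Euc U} (A : V a -> U) (y : U) : V a :=
  fun i => einner y (A (ebasis a i)).

Definition linear_map {T U} `{Euc T} `{Euc U} (A : T -> U) : Prop :=
  (forall x y, A (eadd x y) = eadd (A x) (A y)) /\
  (forall t x, A (escal t x) = escal t (A x)).

Definition is_fderiv {T U} `{Euc T} `{Euc U} (F : T -> U) (z : T) (A : T -> U) : Prop :=
  linear_map A /\
  forall eps, eps > 0 -> exists del, del > 0 /\
    forall w, enorm w < del ->
      enorm (vsub (vsub (F (eadd z w)) (F z)) (A w)) <= eps * enorm w.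

(* the derivative nabla F(z) (meaningful where F is differentiable) *)
Definition fderiv {T U} `{Euc T} `{Euc U} (F : T -> U) (z : T) : T -> U :=
  epsilon (inhabits (fun _ : T => ezero)) (fun A => is_fderiv F z A).

Definition fderiv2 {T U} `{Euc T} `{Euc U} (F : T -> U) (z : T) (v w : T) : U :=
  fderiv (fun z' => fderiv F z' w) z v.

Definition C1_on {T U} `{Euc T} `{Euc U} (F : T -> U) (z0 : T) (del : R) : Prop :=
  (forall z, enorm (vsub z z0) < del -> exists A, is_fderiv F z A) /\
  (forall z, enorm (vsub z z0) < del ->
     forall eps, eps > 0 -> exists d, d > 0 /\
       forall z', enorm (vsub z' z0) < del -> enorm (vsub z' z) < d ->
         forall w, enorm (vsub (fderiv F z' w) (fderiv F z w)) <= eps * enorm w).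

Definition C2_on {T U} `{Euc T} `{Euc U} (F : T -> U) (z0 : T) (del : R) : Prop :=
  C1_on F z0 del /\ forall w, C1_on (fun z => fderiv F z w) z0 del.

Definition C1_around {T U} `{Euc T} `{Euc U} (F : T -> U) (z0 : T) : Prop :=
  exists del, del > 0 /\ C1_on F z0 del.
Definition C2_around {T U} `{Euc T} `{Euc U} (F : T -> U) (z0 : T) : Prop :=
  exists del, del > 0 /\ C2_on F z0 del.

Definition eclosed_set {T} `{Euc T} (S : T -> Prop) : Prop :=
  forall x, (forall eps, eps > 0 -> exists y, S y /\ enorm (vsub y x) < eps) -> S x.

Definition closed_convex_cone {T} `{Euc T} (K : T -> Prop) : Prop :=
  eclosed_set K /\ K ezero /\
  (forall t y, t >= 0 -> K y -> K (escal t y)) /\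
  (forall t y1 y2, 0 <= t <= 1 -> K y1 -> K y2 ->
     K (eadd (escal t y1) (escal (1 - t) y2))).

Definition linK {T} `{Euc T} (K : T -> Prop) (y : T) : Prop :=
  K y /\ K (escal (-1) y).

Definition tangent_cone {T} `{Euc T} (Om : T -> Prop) (zb w : T) : Prop :=
  exists (t : nat -> R) (ws : nat -> T),
    (forall k, t k > 0) /\ Un_cv t 0 /\
    Un_cv (fun k => enorm (vsub (ws k) w)) 0 /\
    (forall k, Om (eadd zb (escal (t k) (ws k)))).

Definition rnormal {T} `{Euc T} (Om : T -> Prop) (zb zs : T) : Prop :=
  Om zb /\
  forall eps, eps > 0 -> exists del, del > 0 /\
    forall z, Om z -> enorm (vsub z zb) < del ->
      einner zs (vsub z zb) <= eps * enorm (vsub z zb).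

Definition crit_cone {T} `{Euc T} (Om : T -> Prop) (zb zs w : T) : Prop :=
  tangent_cone Om zb w /\ einner zs w = 0.

Definition is_dist {T} `{Euc T} (x : T) (S : T -> Prop) (d : R) : Prop :=
  (forall s, S s -> d <= enorm (vsub x s)) /\
  (forall eps, eps > 0 -> exists s, S s /\ enorm (vsub x s) < d + eps).

Section Problem.
Context {n m l k : nat}.

Definition Gamma (g : V m * V n -> V l) (C : V l -> Prop) (p : V m) (x : V n) : Prop :=
  C (g (p, x)).

Definition Ssol (f : V m * V n -> V n) (g : V m * V n -> V l) (C : V l -> Prop)
  (p : V m) (x : V n) : Prop :=
  exists v, rnormal (Gamma g C p) x v /\ eadd (f (p, x)) v = ezero.

Definition robinson (g : V m * V n -> V l) (C : V l -> Prop) (pb : V m) (xb : V n) : Prop :=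
  exists kappa, kappa >= 0 /\ exists rW rU, rW > 0 /\ rU > 0 /\
    forall p x, enorm (vsub p pb) < rW -> enorm (vsub x xb) < rU ->
      forall d, is_dist (g (p, x)) C d ->
        exists d', is_dist x (Gamma g C p) d' /\ d' <= kappa * d.

Definition dpart {U} `{Euc U} (F : V m * V n -> U) (zb : V m * V n) (q : V m) : U :=
  fderiv F zb (q, ezero).
Definition dxpart {U} `{Euc U} (F : V m * V n -> U) (zb : V m * V n) (u : V n) : U :=
  fderiv F zb (ezero, u).

(* nabla g(zb)^* lam = (nabla_p g(zb)^* lam, nabla_x g(zb)^* lam) *)
Definition adjZ (g : V m * V n -> V l) (zb : V m * V n) (lam : V l) : V m * V n :=
  (adj (dpart g zb) lam, adj (dxpart g zb) lam).

(* (nabla h(g zb)^* )^{-1} lam : the (unique) mu with nabla h(g zb)^* mu = lam *)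
Definition hadj_inv (h : V l -> V k) (y0 : V l) (lam : V l) : V k :=
  epsilon (inhabits ezero) (fun mu => adj (fderiv h y0) mu = lam).

Definition Lam (g : V m * V n -> V l) (C : V l -> Prop) (zb zs : V m * V n) (lam : V l) : Prop :=
  rnormal C (g zb) lam /\ adjZ g zb lam = zs.

Definition lam_obj (g : V m * V n -> V l) (h : V l -> V k) (zb v : V m * V n) (lam : V l) : R :=
  einner lam (fderiv2 g zb v v) +
  fderiv2 (fun y => einner (hadj_inv h (g zb) lam) (h y)) (g zb)
     (fderiv g zb v) (fderiv g zb v).

Definition LamV (g : V m * V n -> V l) (h : V l -> V k) (C : V l -> Prop)
  (zb zs v : V m * V n) (lam : V l) : Prop :=
  Lam g C zb zs lam /\
  forall lam', Lam g C zb zs lam' -> lam_obj g h zb v lam' <= lam_obj g h zb v lam.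

Definition Lbar (f : V m * V n -> V n) (g : V m * V n -> V l) (C : V l -> Prop)
  (zb : V m * V n) (lam : V l) : Prop :=
  rnormal C (g zb) lam /\ eadd (f zb) (adj (dxpart g zb) lam) = ezero.

Definition Hx (g : V m * V n -> V l) (h : V l -> V k) (zb : V m * V n) (lam : V l)
  (u : V n) : V n :=
  adj (dxpart g zb)
    (fun j => fderiv2 (fun y => einner (hadj_inv h (g zb) lam) (h y)) (g zb)
                 (ebasis l j) (dxpart g zb u)).

Definition hessx (g : V m * V n -> V l) (zb : V m * V n) (lam : V l) (u : V n) : V n :=
  fun i => fderiv2 (fun z => einner lam (g z)) zb (ezero, ebasis n i) (ezero, u).

Definition Fop (f : V m * V n -> V n) (g : V m * V n -> V l) (h : V l -> V k)
  (zb : V m * V n) (lam : V l) (u : V n) : V n :=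
  eadd (eadd (dxpart f zb u) (hessx g zb lam u)) (Hx g h zb lam u).

Definition Pset (g : V m * V n -> V l) (h : V l -> V k) (K : V k -> Prop)
  (zb : V m * V n) (q : V m) : Prop :=
  exists u w, linK K w /\
    dpart (fun z => h (g z)) zb q = eadd (dxpart (fun z => h (g z)) zb u) w.

End Problem.

(* Main.v *)
(* Suppose the estimate fails along p_j -> pb, x_j -> xb and put t_j = |x_j - xb|, so that
   |p_j - pb| = o(t_j) and dist(p_j - pb; P) = o(t_j^2). Write G = h o g, A for the derivative
   of G at zb and D for its second derivative. By Robinson stability x_j has bounded multipliers
   mu_j in the polar of K; pass to limits mu_j -> mu and (x_j - xb)/t_j -> u. Subtracting the
   stationarity conditions at z_j and zb gives A_x^*(mu_j - mu)/t_j -> - F_mu u. Pairing this with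
   critical directions w yields <F_mu u, w> >= 0. For any other multiplier nu with
   A^* nu = A^* mu one has <mu_j - nu, G(z_j)> >= 0; a second-order expansion turns this into
   <F_mu u, u> <= (1/2) <mu - nu, D(u,u)>, the parameter term being o(t_j^2) because
   mu_j - mu annihilates lin K. Since u is itself critical, mu is a maximiser of
   <., D(u,u)> and <F_mu u, u> <= 0, which contradicts (C1).
   Approximate multipliers suffice, so the exact normal cone calculus is never needed. *)

Require Import Defs.
From Stdlib Require Import Reals Lra Lia List FunctionalExtensionality.
From Stdlib Require Import Classical ClassicalEpsilon.
From Stdlib Require Fin.
Import ListNotations.
Open Scope R_scope.

(** * Euclidean spaces *)

Local Notation "x [+] y" := (eadd x y) (at level 50, left associativity).
Local Notation "x [-] y" := (vsub x y) (at level 50, left associativity).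
Local Notation "t [*] x" := (escal t x) (at level 40, left associativity).

(** The square root balances two orders of smallness. After division by t_j^2 the expansion of <mu_j
    - nu, G(z_j)> contains <mu_j - mu, A_p (p_j - pb)> / t_j^2, and since p_j - pb is only o(t_j),
    the convergence of mu_j does not control this term. Split p_j - pb = b_j + r_j with b_j in P.
    The equation defining P trades A_p b_j for A_x v_j modulo lin K; as A_x^*(mu_j - mu)/t_j
    converges, v_j = o(t_j) is enough, and such v_j exist because a linear relation has a linearly
    bounded selection. For r_j only mu_j -> mu is available, so r_j has to be O(t_j^2), which is
    what the distance under the root provides.

    The multipliers come from a penalty problem and belong to an auxiliary pair: y_j near x_j, and
    q_j in K near G(p_j, y_j). The tolerance t_j^2/(j+1) makes these errors vanish even after
    division by t_j^2. Complementarity <mu_j, q_j> = 0 stays exact, so the sign arguments use q_j in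
    place of G(z_j). *)

Definition comb {T} `{Euc T} (bs : list T) (x : T) : T :=
  fold_right (fun b acc => (einner x b [*] b) [+] acc) ezero bs.

(* Extensionality is postulated against the inner product, so that every
   vector identity becomes a real identity provable by [ring]. *)
Class EucLaws (T : Type) {HT : Euc T} : Prop := {
  inner_sym : forall x y : T, einner x y = einner y x;
  inner_addl : forall x y z : T, einner (x [+] y) z = einner x z + einner y z;
  inner_scall : forall t (x y : T), einner (t [*] x) y = t * einner x y;
  inner_0l : forall x : T, einner ezero x = 0;
  inner_ge0 : forall x : T, 0 <= einner x x;
  inner_ext : forall x y : T, (forall w, einner x w = einner y w) -> x = y;
  finite_basis : exists bs : list T, forall x, comb bs x = x }.

Ltac inner_simpl :=
  unfold vsub; repeat rewrite ?inner_addl, ?inner_scall, ?inner_0l.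
Ltac vec := apply inner_ext; let w := fresh "w" in intro w; inner_simpl;
  try ring.

#[global] Instance EucLaws_R : EucLaws R.
Proof.
split; cbn; try (intros; ring).
- intros x. nra.
- intros x y Hxy. specialize (Hxy 1). lra.
- exists [1]. intros x. cbn. ring.
Qed.

Lemma choice {A B : Type} (R : A -> B -> Prop) :
  (forall x, exists y, R x y) -> exists f, forall x, R x (f x).
Proof.
intros H. exists (fun x => proj1_sig (constructive_indefinite_description _ (H x))).
intros x. apply proj2_sig.
Qed.

Lemma fsum_ext n (a b : Fin.t n -> R) : (forall i, a i = b i) -> fsum n a = fsum n b.
Proof. intros H. f_equal. now apply functional_extensionality. Qed.

Lemma fsum_add n (a b : Fin.t n -> R) : fsum n (fun i => a i + b i) = fsum n a + fsum n b.
Proof. induction n as [|n IH]; cbn; [ring|]. rewrite IH. ring. Qed.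

Lemma fsum_scal n c (a : Fin.t n -> R) : fsum n (fun i => c * a i) = c * fsum n a.
Proof. induction n as [|n IH]; cbn; [ring|]. rewrite IH. ring. Qed.

Lemma fsum_0 n : fsum n (fun _ => 0) = 0.
Proof. induction n as [|n IH]; cbn; [ring|]. rewrite IH. ring. Qed.

Lemma fsum_sq_ge0 n (a : Fin.t n -> R) : 0 <= fsum n (fun i => a i * a i).
Proof.
induction n as [|n IH]; cbn; [lra|].
specialize (IH (fun i => a (Fin.FS i))). cbn in IH. nra.
Qed.

Definition vcons {n} (t : R) (x : V n) : V (S n) :=
  fun i => Fin.caseS' i (fun _ => R) t x.

Lemma vcons_eta n (x : V (S n)) : x = vcons (x Fin.F1) (fun i => x (Fin.FS i)).
Proof.
apply functional_extensionality. intros i.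
apply (Fin.caseS' i (fun i => x i = vcons (x Fin.F1) (fun i => x (Fin.FS i)) i));
reflexivity.
Qed.

Lemma vcons_add n a b (x y : V n) : vcons (a + b) (x [+] y) = vcons a x [+] vcons b y.
Proof.
apply functional_extensionality. intros i.
apply (Fin.caseS' i (fun i => vcons (a + b) (x [+] y) i = (vcons a x [+] vcons b y) i));
reflexivity.
Qed.

Lemma vcons_scal n t a (x : V n) : vcons (t * a) (t [*] x) = t [*] vcons a x.
Proof.
apply functional_extensionality. intros i.
apply (Fin.caseS' i (fun i => vcons (t * a) (t [*] x) i = (t [*] vcons a x) i));
reflexivity.
Qed.

Lemma ebasis_F1 n : ebasis (S n) Fin.F1 = vcons 1 ezero.
Proof.
rewrite (vcons_eta _ (ebasis _ _)). f_equal.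
unfold ebasis. now destruct (Fin.eq_dec Fin.F1 Fin.F1).
Qed.

Lemma ebasis_FS n (i : Fin.t n) : ebasis (S n) (Fin.FS i) = vcons 0 (ebasis n i).
Proof.
rewrite (vcons_eta _ (ebasis _ _)).
change (ebasis (S n) (Fin.FS i) Fin.F1) with 0. f_equal.
- apply functional_extensionality. intros j. unfold ebasis.
  destruct (Fin.eq_dec (Fin.FS i) (Fin.FS j)) as [e|e], (Fin.eq_dec i j) as [e'|e'];
    try reflexivity.
  + apply Fin.FS_inj in e. contradiction.
  + subst. contradiction.
Qed.

(** Riesz representation in coordinates. It turns [adj], which is prescribed on basis vectors only,
    into a true adjoint. *)
Lemma functional_coords n (L : V n -> R) : linear_map L ->
  forall x, L x = fsum n (fun i => L (ebasis n i) * x i).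
Proof.
induction n as [|n IH]; intros [La Ls] x; cbn.
- assert (x = 0 [*] x) as -> by
    (apply functional_extensionality; intros i; exact (Fin.case0 (fun _ => _) i)).
  rewrite Ls. cbn. ring.
- rewrite (vcons_eta n x) at 1.
  set (x' := fun i => x (Fin.FS i)). set (a := x Fin.F1).
  assert (vcons a x' = a [*] vcons 1 ezero [+] vcons 0 x') as ->.
  { rewrite <- vcons_scal, <- vcons_add. f_equal; [ring|].
    apply functional_extensionality. intros i. cbn. ring. }
  rewrite La, Ls, ebasis_F1. cbn [escal eadd Euc_R].
  rewrite (IH (fun y => L (vcons 0 y))).
  + rewrite Rmult_comm. f_equal. apply fsum_ext. intros i. now rewrite ebasis_FS.
  + split.
    * intros y z. rewrite <- La, <- vcons_add. now rewrite Rplus_0_l.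
    * intros t y. rewrite <- Ls, <- vcons_scal. now rewrite Rmult_0_r.
Qed.

Lemma inner_vcons n a b (x y : V n) :
  einner (vcons a x) (vcons b y) = a * b + einner x y.
Proof. reflexivity. Qed.

(** A list with [comb bs x = x] for all [x] is a Parseval frame, the form of finite dimension in
    which linear statements are proved summand by summand. Padding by a zero coordinate preserves
    the expansion, so one more unit vector yields a frame of [V (S n)]. *)
Lemma comb_vcons n (bs : list (V n)) (a : R) (x : V n) :
  comb (map (vcons 0) bs) (vcons a x) = vcons 0 (comb bs x).
Proof.
induction bs as [|b bs IH]; cbn [comb fold_right map].
- now rewrite (vcons_eta _ ezero).
- fold (comb (map (vcons 0) bs) (vcons a x)). fold (comb bs x).
  rewrite IH, inner_vcons, <- vcons_scal, <- vcons_add. f_equal; [ring|].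
  f_equal. f_equal. ring.
Qed.

#[global] Instance EucLaws_V n : EucLaws (V n).
Proof.
assert (Hsym : forall x y : V n, einner x y = einner y x).
{ intros x y. apply fsum_ext. intros i. ring. }
assert (Hfun : forall x : V n, linear_map (fun y : V n => einner x y)).
{ intros x. split; cbn; intros; [rewrite <- fsum_add|rewrite <- fsum_scal];
  apply fsum_ext; intros i; ring. }
split; auto.
- intros x y z. rewrite Hsym, (proj1 (Hfun z)). cbn. rewrite <- !fsum_add.
  apply fsum_ext. intros i. ring.
- intros t x y. rewrite Hsym, (proj2 (Hfun y)), Hsym. reflexivity.
- intros x. etransitivity; [|exact (fsum_0 n)]. apply fsum_ext. intros; cbn; ring.
- intros x. apply fsum_sq_ge0.
- clear Hsym Hfun. induction n as [|n IH]; intros x y Hxy.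
  + apply functional_extensionality. intros i. exact (Fin.case0 (fun _ => _) i).
  + rewrite (vcons_eta n x), (vcons_eta n y).
    rewrite (vcons_eta n x), (vcons_eta n y) in Hxy.
    f_equal.
    * specialize (Hxy (vcons 1 ezero)). rewrite !inner_vcons in Hxy. cbn in Hxy.
      rewrite (fsum_ext n _ (fun _ => 0)), (fsum_ext n (fun i => y _ * 0) (fun _ => 0)), fsum_0
        in Hxy by (intros; ring). lra.
    * apply IH. intros w. specialize (Hxy (vcons 0 w)). rewrite !inner_vcons in Hxy. lra.
- clear Hsym Hfun. induction n as [|n [bs IH]].
  + exists []. intros x. apply functional_extensionality.
    intros i. exact (Fin.case0 (fun _ => _) i).
  + exists (vcons 1 ezero :: map (vcons 0) bs). intros x.
    rewrite (vcons_eta n x). set (a := x Fin.F1). set (x' := (fun i => x (Fin.FS i)) : V n).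
    change (einner (vcons a x') (vcons 1 ezero) [*] vcons 1 ezero
            [+] comb (map (vcons 0) bs) (vcons a x') = vcons a x').
    rewrite comb_vcons, IH, inner_vcons, <- vcons_scal, <- vcons_add.
    assert (einner x' ezero = 0) as ->.
    { cbn. rewrite (fsum_ext n _ (fun _ => 0)) by (intros; ring). apply fsum_0. }
    f_equal; [ring|].
    apply functional_extensionality. intros i. cbn. ring.
Qed.

#[global] Instance EucLaws_prod T U (HT : Euc T) (HU : Euc U) :
  EucLaws T -> EucLaws U -> EucLaws (T * U).
Proof.
intros LT LU. split.
- intros [] []. cbn. now rewrite (inner_sym t), (inner_sym u).
- intros [] [] []. cbn. rewrite !inner_addl. ring.
- intros ? [] []. cbn. rewrite !inner_scall. ring.
- intros []. cbn. rewrite !inner_0l. ring.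
- intros []. cbn. pose proof (inner_ge0 t). pose proof (inner_ge0 u). lra.
- intros [x x'] [y y'] Hxy. cbn in Hxy. f_equal; apply inner_ext; intros w.
  + specialize (Hxy (w, ezero)). cbn in Hxy.
    rewrite (inner_sym x'), (inner_sym y'), !inner_0l in Hxy. lra.
  + specialize (Hxy (ezero, w)). cbn in Hxy.
    rewrite (inner_sym x), (inner_sym y), !inner_0l in Hxy. lra.
- destruct (finite_basis (T := T)) as [bs Hbs], (finite_basis (T := U)) as [cs Hcs].
  exists (map (fun b => (b, ezero)) bs ++ map (fun c => (ezero, c)) cs).
  intros [x y].
  assert (H2 : comb (map (fun c => (ezero, c)) cs) (x, y) = (ezero, y)).
  { rewrite <- (Hcs y) at 2. clear Hbs Hcs. induction cs as [|c cs IH]; [reflexivity|].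
    cbn [comb map fold_right]. fold (comb (map (fun c => (ezero : T, c)) cs) (x, y)).
    rewrite IH. cbn. rewrite (inner_sym x), inner_0l, Rplus_0_l.
    f_equal. vec. }
  transitivity ((comb bs x, ezero) [+] ((ezero, y) : T * U)).
  2: { rewrite Hbs. cbn. f_equal; vec. }
  clear Hbs Hcs. induction bs as [|b bs IH]; cbn [comb map fold_right app].
  + fold (comb (map (fun c => (ezero : T, c)) cs) (x, y)). rewrite H2. cbn. f_equal; vec.
  + fold (comb (map (fun b => (b, ezero : U)) bs ++ map (fun c => (ezero : T, c)) cs) (x, y)).
    rewrite IH. fold (comb bs x). cbn. rewrite (inner_sym y), inner_0l. f_equal; vec.
Qed.

(** * Norm, Cauchy-Schwarz and the triangle inequality *)

Section Euclid.
Context {T : Type} {HT : Euc T} {LT : EucLaws T}.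
Implicit Types x y z : T.

Lemma inner_addr x y z : einner z (x [+] y) = einner z x + einner z y.
Proof. now rewrite inner_sym, inner_addl, !(inner_sym z). Qed.
Lemma inner_scalr t x y : einner y (t [*] x) = t * einner y x.
Proof. now rewrite inner_sym, inner_scall, (inner_sym y). Qed.
Lemma inner_0r x : einner x ezero = 0.
Proof. now rewrite inner_sym, inner_0l. Qed.

Lemma enorm_ge0 x : 0 <= enorm x.
Proof. apply sqrt_pos. Qed.
Lemma enorm_sq x : enorm x * enorm x = einner x x.
Proof. apply sqrt_sqrt, inner_ge0. Qed.

Lemma enorm_0 : enorm (ezero : T) = 0.
Proof. unfold enorm. rewrite inner_0l. apply sqrt_0. Qed.

Lemma enorm_scal t x : enorm (t [*] x) = Rabs t * enorm x.
Proof.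
unfold enorm. rewrite inner_scall, inner_scalr, <- Rmult_assoc, sqrt_mult_alt by nra.
f_equal. apply sqrt_Rsqr_abs.
Qed.

Lemma cauchy_schwarz x y : Rabs (einner x y) <= enorm x * enorm y.
Proof.
assert (H : einner x y * einner x y <= einner x x * einner y y).
{ set (a := einner x x). set (b := einner x y). set (c := einner y y).
  assert (Q : forall t, 0 <= a + 2 * t * b + t * t * c).
  { intros t. pose proof (inner_ge0 (x [+] t [*] y)) as P.
    rewrite inner_addl, !inner_addr, !inner_scall, !inner_scalr, (inner_sym y x) in P.
    fold a b c in P. lra. }
  pose proof (inner_ge0 x) as Ha. pose proof (inner_ge0 y) as Hc. fold a in Ha. fold c in Hc.
  destruct (Req_dec c 0) as [E|E].
  (* With [c = 0] the polynomial in [t] is affine; this [t] gives it the value [-1] unless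
     [b = 0]. *)
  - rewrite E in *. specialize (Q (- (a + 1) * b / (2 * (b * b)))).
    destruct (Req_dec b 0) as [->|B]; [lra|].
    exfalso. replace (2 * (- (a + 1) * b / (2 * (b * b))) * b) with (- (a + 1)) in Q by now field.
    lra.
  - specialize (Q (- b / c)).
    replace (a + 2 * (- b / c) * b + - b / c * (- b / c) * c) with ((a * c - b * b) / c) in Q
      by now field.
    assert (0 < c) by lra.
    apply (Rmult_le_compat_r c) in Q; [|lra]. unfold Rdiv in Q.
    rewrite Rmult_assoc, Rinv_l in Q; lra. }
apply Rsqr_incr_0; [| apply Rabs_pos | apply Rmult_le_pos; apply enorm_ge0].
rewrite <- Rsqr_abs. unfold Rsqr.
pose proof (enorm_sq x). pose proof (enorm_sq y). nra.
Qed.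

Lemma inner_le x y : einner x y <= enorm x * enorm y.
Proof. eapply Rle_trans; [apply Rle_abs|apply cauchy_schwarz]. Qed.

Lemma enorm_add x y : enorm (x [+] y) <= enorm x + enorm y.
Proof.
pose proof (enorm_ge0 x). pose proof (enorm_ge0 y).
apply Rsqr_incr_0; [| apply enorm_ge0 | lra].
unfold Rsqr. rewrite enorm_sq, inner_addl, !inner_addr, (inner_sym y x).
pose proof (inner_le x y). pose proof (enorm_sq x). pose proof (enorm_sq y). nra.
Qed.

Lemma enorm_opp x y : enorm (x [-] y) = enorm (y [-] x).
Proof.
replace (x [-] y) with ((-1) [*] (y [-] x)) by vec.
rewrite enorm_scal, Rabs_left by lra. lra.
Qed.

Lemma enorm_tri x y z : enorm (x [-] z) <= enorm (x [-] y) + enorm (y [-] z).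
Proof.
replace (x [-] z) with ((x [-] y) [+] (y [-] z)) by vec. apply enorm_add.
Qed.

Lemma enorm_le_add x y : enorm x <= enorm y + enorm (x [-] y).
Proof.
replace x with (y [+] (x [-] y)) at 1 by vec. apply enorm_add.
Qed.

Lemma vsub_diag x : x [-] x = ezero.
Proof. vec. Qed.

Lemma vsub_0r x : x [-] ezero = x.
Proof. vec. Qed.

Lemma add_vsub x y : x [+] (y [-] x) = y.
Proof. vec. Qed.

Lemma vsub_add x y : (x [+] y) [-] x = y.
Proof. vec. Qed.

Lemma enorm_eq0 x : enorm x = 0 -> x = ezero.
Proof.
intros H. apply inner_ext. intros w. rewrite inner_0l.
pose proof (cauchy_schwarz x w) as C. rewrite H, Rmult_0_l in C.
apply NNPP. intros N. pose proof (Rabs_pos_lt _ N). lra.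
Qed.

Lemma vsub_eq0 x y : enorm (x [-] y) = 0 -> x = y.
Proof.
intros H. apply enorm_eq0 in H. rewrite <- (add_vsub y x), H. vec.
Qed.

End Euclid.

(** * Linear maps, adjoints and right inverses *)

Section Linear.
Context {T U : Type} {HT : Euc T} {LT : EucLaws T} {HU : Euc U} {LU : EucLaws U}.
Variable A : T -> U.
Hypothesis HA : linear_map A.

Lemma lin_add x y : A (x [+] y) = A x [+] A y.
Proof. apply HA. Qed.
Lemma lin_scal t x : A (t [*] x) = t [*] A x.
Proof. apply HA. Qed.
Lemma lin_0 : A ezero = ezero.
Proof.
replace (ezero : T) with (0 [*] (ezero : T)) by vec. rewrite lin_scal. vec.
Qed.
Lemma lin_sub x y : A (x [-] y) = A x [-] A y.
Proof. unfold vsub. now rewrite lin_add, lin_scal. Qed.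

Lemma lin_comb bs x :
  A (comb bs x) = fold_right (fun b acc => (einner x b [*] A b) [+] acc) ezero bs.
Proof.
induction bs as [|b bs IH]; [exact lin_0|]. cbn. fold (comb bs x).
now rewrite lin_add, lin_scal, IH.
Qed.

Lemma lin_bounded : exists c, 0 < c /\ forall x, enorm (A x) <= c * enorm x.
Proof.
assert (B : forall bs, exists c, 0 < c /\ forall x, enorm (A (comb bs x)) <= c * enorm x).
{ induction bs as [|b bs [c [Hc IH]]].
  - exists 1. split; [lra|]. intros x. cbn. rewrite lin_0, enorm_0.
    pose proof (enorm_ge0 x). lra.
  - exists (enorm b * enorm (A b) + c). split.
    { pose proof (enorm_ge0 b). pose proof (enorm_ge0 (A b)). nra. }
    intros x. cbn. fold (comb bs x). rewrite lin_add, lin_scal.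
    eapply Rle_trans; [apply enorm_add|]. rewrite enorm_scal.
    specialize (IH x). pose proof (cauchy_schwarz x b). pose proof (enorm_ge0 (A b)).
    assert (Rabs (einner x b) * enorm (A b) <= enorm x * enorm b * enorm (A b))
      by now apply Rmult_le_compat_r. lra. }
destruct (finite_basis (T := T)) as [bs Hbs]. destruct (B bs) as [c [Hc H]].
exists c. split; [exact Hc|]. intros x. now rewrite <- (Hbs x) at 1.
Qed.

End Linear.

Lemma linear_comp {T U W} `{Euc T} `{Euc U} `{Euc W} (A : T -> U) (B : U -> W) :
  linear_map A -> linear_map B -> linear_map (fun x => B (A x)).
Proof.
intros [Aa As] [Ba Bs]. split; intros; [now rewrite Aa, Ba|now rewrite As, Bs].
Qed.

Lemma linear_inner {T U} `{Euc T} `{EucLaws U} (b : U) (A : T -> U) :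
  linear_map A -> linear_map (fun x => einner b (A x)).
Proof.
intros [Aa As]. split; intros.
- now rewrite Aa, inner_addr.
- now rewrite As, inner_scalr.
Qed.

Lemma adj_spec {a : nat} {U} `{EucLaws U} (A : V a -> U) (y : U) (x : V a) :
  linear_map A -> einner (adj A y) x = einner y (A x).
Proof.
intros HA.
rewrite (functional_coords a (fun x => einner y (A x))) by now apply linear_inner.
reflexivity.
Qed.

(** Any section [s] of [A] will do, however irregular: it is evaluated only on the frame, and
    linearity comes from the coefficients [einner e b]. *)
Lemma surjective_right_inverse {T U} `{EucLaws T} `{EucLaws U} (A : T -> U) :
  linear_map A -> (forall e, exists y, A y = e) ->
  exists B : U -> T, linear_map B /\ forall e, A (B e) = e.
Proof.
intros HA Hs. apply choice in Hs as [s Hs].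
destruct (finite_basis (T := U)) as [bs Hbs].
set (B := fun bs e => fold_right (fun b acc => (einner e b [*] s b) [+] acc) ezero bs).
exists (B bs). split.
- clear Hbs. induction bs as [|b bs [Ia Is]]; split; intros; cbn; try (vec; fail).
  + fold (B bs (x [+] y)) (B bs x) (B bs y). rewrite Ia. vec.
  + fold (B bs (t [*] x)) (B bs x). rewrite Is. vec.
- intros e. rewrite <- (Hbs e) at 2. clear Hbs. induction bs as [|b bs IH]; cbn.
  + now apply lin_0.
  + fold (B bs e) (comb bs e).
    now rewrite (lin_add A HA), (lin_scal A HA), IH, Hs.
Qed.

(** * Sequences and compactness *)

Definition evt (P : nat -> Prop) := exists N, forall j, (N <= j)%nat -> P j.

Lemma evt_all (P : nat -> Prop) : (forall j, P j) -> evt P.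
Proof. intros H. now exists 0%nat. Qed.

Lemma evt_and (P Q : nat -> Prop) : evt P -> evt Q -> evt (fun j => P j /\ Q j).
Proof.
intros [N HN] [M HM]. exists (N + M)%nat. intros j Hj. split; [apply HN|apply HM]; lia.
Qed.

Lemma evt_mono (P Q : nat -> Prop) : (forall j, P j -> Q j) -> evt P -> evt Q.
Proof. intros H [N HN]. exists N. auto. Qed.

Lemma evt_lt a l e : Un_cv a l -> 0 < e -> evt (fun j => Rabs (a j - l) < e).
Proof. intros H He. destruct (H e He) as [N HN]. exists N. exact HN. Qed.

Lemma Un_cv_evt_eq a b l : evt (fun j => a j = b j) -> Un_cv a l -> Un_cv b l.
Proof.
intros E H e He. destruct (evt_and _ _ E (evt_lt _ _ _ H He)) as [N HN].
exists N. intros j Hj. destruct (HN j Hj) as [<- ?]. assumption.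
Qed.

Lemma Un_cv_squeeze a b : evt (fun j => Rabs (a j) <= b j) -> Un_cv b 0 -> Un_cv a 0.
Proof.
intros E H e He. destruct (evt_and _ _ E (evt_lt _ _ _ H He)) as [N HN].
exists N. intros j Hj. destruct (HN j Hj) as [H1 H2].
unfold R_dist. rewrite Rminus_0_r in *. pose proof (Rle_abs (b j)). lra.
Qed.

Lemma Un_cv_const c : Un_cv (fun _ => c) c.
Proof. intros e He. exists 0%nat. intros. unfold R_dist. rewrite Rminus_diag, Rabs_R0. lra. Qed.

Lemma Un_cv_le a b l m : evt (fun j => a j <= b j) -> Un_cv a l -> Un_cv b m -> l <= m.
Proof.
intros E Ha Hb. apply Rnot_lt_le. intros C.
assert (He : 0 < (l - m) / 2) by lra.
destruct (evt_and _ _ E (evt_and _ _ (evt_lt _ _ _ Ha He) (evt_lt _ _ _ Hb He))) as [N HN].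
destruct (HN N (le_n _)) as [H1 [H2 H3]].
apply Rabs_def2 in H2, H3. lra.
Qed.

Lemma Un_cv_shift a l : Un_cv a l <-> Un_cv (fun j => a j - l) 0.
Proof.
split; intros H e He; destruct (H e He) as [N HN]; exists N; intros j Hj;
  specialize (HN j Hj); unfold R_dist in *; now rewrite ?Rminus_0_r in *.
Qed.

Lemma Un_cv_inv_S : Un_cv (fun j => / INR (S j)) 0.
Proof.
apply (Un_cv_evt_eq RinvN); [|exact RinvN_cv].
apply evt_all. intros j. cbn [RinvN pos]. now rewrite S_INR.
Qed.

Lemma Un_cv_of_evt a l : (forall e, 0 < e -> evt (fun j => Rabs (a j - l) < e)) -> Un_cv a l.
Proof. intros H e He. destruct (H e He) as [N HN]. exists N. exact HN. Qed.

Lemma inv_INR_S_pos j : 0 < / INR (S j).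
Proof. apply Rinv_0_lt_compat, lt_0_INR. lia. Qed.

Lemma inv_INR_S_le i j : (i <= j)%nat -> / INR (S j) <= / INR (S i).
Proof. intros H. apply Rinv_le_contravar; [apply lt_0_INR; lia|apply le_INR; lia]. Qed.

Definition extraction (phi : nat -> nat) := forall j, (phi j < phi (S j))%nat.

Lemma extraction_ge phi : extraction phi -> forall j, (j <= phi j)%nat.
Proof. intros H j. induction j as [|j IH]; [lia|]. specialize (H j). lia. Qed.

Lemma extraction_comp phi psi :
  extraction phi -> extraction psi -> extraction (fun j => phi (psi j)).
Proof.
intros Hp Hq j. specialize (Hq j).
assert (M : forall a b, (a < b)%nat -> (phi a < phi b)%nat).
{ intros a b Hab. induction Hab as [|b Hab IH]; [apply Hp|]. specialize (Hp b). lia. }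
now apply M.
Qed.

Lemma evt_extraction phi (P : nat -> Prop) :
  extraction phi -> evt P -> evt (fun j => P (phi j)).
Proof.
intros H [N HN]. exists N. intros j Hj. apply HN. pose proof (extraction_ge _ H j). lia.
Qed.

Lemma Un_cv_extraction phi a l : extraction phi -> Un_cv a l -> Un_cv (fun j => a (phi j)) l.
Proof.
intros H Ha. apply Un_cv_of_evt. intros e He.
apply (evt_extraction phi (fun j => Rabs (a j - l) < e) H). now apply evt_lt.
Qed.

Lemma bolzano_weierstrass_R (a : nat -> R) M : (forall j, Rabs (a j) <= M) ->
  exists phi l, extraction phi /\ Un_cv (fun j => a (phi j)) l.
Proof.
intros Hb.
destruct (Bolzano_Weierstrass a (fun x => - M <= x <= M) (compact_P3 (- M) M)) as [l Hl].
{ intros j. specialize (Hb j). split; [|pose proof (Rle_abs (a j)); lra].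
  pose proof (Rle_abs (- a j)). rewrite Rabs_Ropp in *. lra. }
assert (Hc : forall Ne : nat * nat, exists p, (fst Ne <= p)%nat /\ Rabs (a p - l) < / INR (S (snd Ne))).
{ intros [N e]. cbn [fst snd].
  destruct (Hl (fun x => Rabs (x - l) < / INR (S e)) N) as [p Hp]; [|now exists p].
  exists (mkposreal _ (inv_INR_S_pos e)). intros x Hx. exact Hx. }
apply choice in Hc as [c Hc].
(* The first argument of [c] forces a strictly larger index, the second asks for accuracy
   [/ INR (S j)] at position [j]. *)
set (phi := fix phi j := match j with O => c (O, O) | S i => c (S (phi i), S i) end).
assert (Hphi : extraction phi).
{ intros j. cbn [phi]. destruct (Hc (S (phi j), S j)) as [H _]. cbn in H. exact H. }
exists phi, l. split; [exact Hphi|].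
apply Un_cv_shift, (Un_cv_squeeze _ (fun j => / INR (S j))); [|exact Un_cv_inv_S].
apply evt_all. intros [|j]; left; cbn [phi]; now apply Hc.
Qed.

(** * Convergence and compactness in Euclidean spaces *)

Definition cv {T} `{Euc T} (x : nat -> T) (l : T) := Un_cv (fun j => enorm (x j [-] l)) 0.

Section Seq.
Context {T : Type} {HT : Euc T} {LT : EucLaws T}.
Implicit Types x y : nat -> T.

Lemma cv_inner_const x l w : cv x l -> Un_cv (fun j => einner (x j) w) (einner l w).
Proof.
intros H. apply Un_cv_shift, (Un_cv_squeeze _ (fun j => enorm (x j [-] l) * enorm w)).
- apply evt_all. intros j.
  replace (einner (x j) w - einner l w) with (einner (x j [-] l) w) by (inner_simpl; ring).
  apply cauchy_schwarz.
- replace 0 with (0 * enorm w) by ring. apply CV_mult; [exact H|apply Un_cv_const].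
Qed.

Lemma Un_cv_sqrt0 a : (forall j, 0 <= a j) -> Un_cv a 0 -> Un_cv (fun j => sqrt (a j)) 0.
Proof.
intros Ha H. apply Un_cv_of_evt. intros e He.
assert (He2 : 0 < e * e) by nra.
apply (evt_mono _ _) with (2 := evt_lt _ _ _ H He2). intros j Hj.
rewrite Rminus_0_r in *. rewrite Rabs_right in Hj by (apply Rle_ge, Ha).
rewrite Rabs_right by (apply Rle_ge, sqrt_pos).
rewrite <- (sqrt_square e) by lra. apply sqrt_lt_1; [apply Ha|lra|exact Hj].
Qed.

Lemma comb_inner_cv bs (a : nat -> T) :
  (forall w, Un_cv (fun j => einner (a j) w) 0) ->
  Un_cv (fun j => einner (comb bs (a j)) (a j)) 0.
Proof.
intros H. induction bs as [|b bs IH]; cbn.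
- apply (Un_cv_evt_eq (fun _ => 0)); [|apply Un_cv_const].
  apply evt_all. intros j. now rewrite inner_0l.
- apply (Un_cv_evt_eq (fun j => einner (a j) b * einner (a j) b + einner (comb bs (a j)) (a j))).
  + apply evt_all. intros j. fold (comb bs (a j)).
    rewrite inner_addl, inner_scall, (inner_sym b). ring.
  + replace 0 with (0 * 0 + 0) by ring. apply CV_plus; [apply CV_mult; apply H|exact IH].
Qed.

(** With a Parseval frame, |x_j - l|^2 is the finite sum of the squares <x_j - l, b>^2. Vector
    limits thereby reduce to the scalar limit theorems. *)
Lemma cv_weak x l : (forall w, Un_cv (fun j => einner (x j) w) (einner l w)) -> cv x l.
Proof.
intros H. apply Un_cv_sqrt0; [intros; apply inner_ge0|].
destruct (finite_basis (T := T)) as [bs Hbs].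
apply (Un_cv_evt_eq (fun j => einner (comb bs (x j [-] l)) (x j [-] l))).
- apply evt_all. intros j. now rewrite Hbs.
- apply comb_inner_cv. intros w.
  apply (Un_cv_evt_eq (fun j => einner (x j) w - einner l w)).
  + apply evt_all. intros j. inner_simpl. ring.
  + apply -> Un_cv_shift. apply H.
Qed.

Lemma cv_ext x y l : evt (fun j => x j = y j) -> cv x l -> cv y l.
Proof. intros E. apply Un_cv_evt_eq. revert E. apply evt_mono. now intros j ->. Qed.

Lemma cv_eq x y l l' : (forall j, x j = y j) -> l = l' -> cv x l -> cv y l'.
Proof. intros E ->. apply cv_ext. now apply evt_all. Qed.

Lemma cv_const (c : T) : cv (fun _ => c) c.
Proof.
apply (Un_cv_evt_eq (fun _ => 0)); [|apply Un_cv_const].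
apply evt_all. intros _. now rewrite vsub_diag, enorm_0.
Qed.

Lemma cv_add x y a b : cv x a -> cv y b -> cv (fun j => x j [+] y j) (a [+] b).
Proof.
intros Hx Hy. apply cv_weak. intros w. rewrite inner_addl.
apply (Un_cv_evt_eq (fun j => einner (x j) w + einner (y j) w)).
- apply evt_all. intros j. now rewrite inner_addl.
- apply CV_plus; now apply cv_inner_const.
Qed.

Lemma cv_scal s x t l : Un_cv s t -> cv x l -> cv (fun j => s j [*] x j) (t [*] l).
Proof.
intros Hs Hx. apply cv_weak. intros w. rewrite inner_scall.
apply (Un_cv_evt_eq (fun j => s j * einner (x j) w)).
- apply evt_all. intros j. now rewrite inner_scall.
- apply CV_mult; [exact Hs|now apply cv_inner_const].
Qed.

Lemma cv_sub x y a b : cv x a -> cv y b -> cv (fun j => x j [-] y j) (a [-] b).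
Proof. intros Hx Hy. apply cv_add; [exact Hx|]. apply cv_scal; [apply Un_cv_const|exact Hy]. Qed.

Lemma cv_unique x a b : cv x a -> cv x b -> a = b.
Proof.
intros Ha Hb. apply inner_ext. intros w.
apply (UL_sequence (fun j => einner (x j) w)); now apply cv_inner_const.
Qed.

Lemma cv_enorm0 x : cv x ezero <-> Un_cv (fun j => enorm (x j)) 0.
Proof.
split; apply Un_cv_evt_eq, evt_all; intros j; now rewrite vsub_0r.
Qed.

Lemma cv_squeeze x (b : nat -> R) : evt (fun j => enorm (x j) <= b j) -> Un_cv b 0 -> cv x ezero.
Proof.
intros E Hb. apply cv_enorm0, (Un_cv_squeeze _ b); [|exact Hb].
revert E. apply evt_mono. intros j Hj. rewrite Rabs_right; [exact Hj|apply Rle_ge, enorm_ge0].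
Qed.

Lemma cv_shift x l : cv x l <-> cv (fun j => x j [-] l) ezero.
Proof. rewrite cv_enorm0. reflexivity. Qed.

Lemma cv_enorm x l : cv x l -> Un_cv (fun j => enorm (x j)) (enorm l).
Proof.
intros H. apply Un_cv_shift, (Un_cv_squeeze _ (fun j => enorm (x j [-] l))); [|exact H].
apply evt_all. intros j. apply Rabs_le. pose proof (enorm_le_add (x j) l).
pose proof (enorm_le_add l (x j)). rewrite (enorm_opp l) in *. lra.
Qed.

Lemma cv_inner x y a b : cv x a -> cv y b -> Un_cv (fun j => einner (x j) (y j)) (einner a b).
Proof.
intros Hx Hy.
apply (Un_cv_evt_eq (fun j => einner (x j [-] a) (y j) + einner (y j) a)).
{ apply evt_all. intros j. inner_simpl. rewrite (inner_sym a). ring. }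
replace (einner a b) with (0 + einner b a) by (rewrite inner_sym; ring).
apply CV_plus; [|now apply cv_inner_const].
apply (Un_cv_squeeze _ (fun j => enorm (x j [-] a) * enorm (y j))).
- apply evt_all. intros j. apply cauchy_schwarz.
- replace 0 with (0 * enorm b) by ring. apply CV_mult; [exact Hx|now apply cv_enorm].
Qed.

Lemma cv_extraction phi x l : extraction phi -> cv x l -> cv (fun j => x (phi j)) l.
Proof. intros H Hx. exact (Un_cv_extraction phi _ _ H Hx). Qed.

Lemma evt_near x l e : cv x l -> 0 < e -> evt (fun j => enorm (x j [-] l) < e).
Proof.
intros H He. generalize (evt_lt _ _ _ H He). apply evt_mono. intros j.
rewrite Rminus_0_r. pose proof (Rle_abs (enorm (x j [-] l))). lra.
Qed.

Lemma evt_bounded x l : cv x l -> evt (fun j => enorm (x j) <= enorm l + 1).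
Proof.
intros H. generalize (evt_near x l 1 H Rlt_0_1). apply evt_mono. intros j Hj.
pose proof (enorm_le_add (x j) l). lra.
Qed.

Lemma bolzano_weierstrass x M : (forall j, enorm (x j) <= M) ->
  exists phi l, extraction phi /\ cv (fun j => x (phi j)) l.
Proof.
intros Hb.
assert (B : forall bs, exists phi l, extraction phi /\ cv (fun j => comb bs (x (phi j))) l).
{ induction bs as [|b bs (phi & l & Hphi & Hl)].
  - exists (fun j => j), ezero. split; [intros j; lia|exact (cv_const ezero)].
  - destruct (bolzano_weierstrass_R (fun j => einner (x (phi j)) b) (M * enorm b))
      as (psi & r & Hpsi & Hr).
    { intros j. eapply Rle_trans; [apply cauchy_schwarz|].
      apply Rmult_le_compat_r; [apply enorm_ge0|apply Hb]. }
    exists (fun j => phi (psi j)), (r [*] b [+] l). split; [now apply extraction_comp|].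
    cbn. apply cv_add.
    + apply cv_scal; [exact Hr|apply cv_const].
    + exact (cv_extraction psi _ _ Hpsi Hl). }
destruct (finite_basis (T := T)) as [bs Hbs]. destruct (B bs) as (phi & l & Hphi & Hl).
exists phi, l. split; [exact Hphi|]. revert Hl. now apply cv_eq.
Qed.

(** The direct method. Closedness and continuity are sequential and relative to [S], because the
    objectives to which it is applied are controlled only on a small ball. *)
Lemma minimum_attained (S : T -> Prop) (F : T -> R) (x0 : T) M m :
  S x0 -> (forall z, S z -> enorm z <= M) ->
  (forall x l, (forall j, S (x j)) -> cv x l -> S l) ->
  (forall z, S z -> m <= F z) ->
  (forall x l, (forall j, S (x j)) -> S l -> cv x l -> Un_cv (fun j => F (x j)) (F l)) ->
  exists z, S z /\ forall z', S z' -> F z <= F z'.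
Proof.
intros Hx0 HM Hcl Hm HF.
destruct (completeness (fun r => exists z, S z /\ r = - F z)) as [s [Hub Hlub]].
{ exists (- m). intros r [z [Hz ->]]. specialize (Hm z Hz). lra. }
{ now exists (- F x0), x0. }
assert (Hseq : forall j, exists z, S z /\ F z < - s + / INR (Datatypes.S j)).
{ intros j. apply NNPP. intros N. pose proof (inv_INR_S_pos j).
  assert (s <= s - / INR (Datatypes.S j)); [|lra].
  apply Hlub. intros r [z [Hz ->]]. apply Rnot_lt_le. intros C. apply N. exists z.
  split; [exact Hz|lra]. }
apply choice in Hseq as [x Hx].
destruct (bolzano_weierstrass x M) as (phi & l & Hphi & Hl).
{ intros j. apply HM, Hx. }
assert (HSl : S l) by (apply (Hcl (fun j => x (phi j))); [intros j; apply Hx|exact Hl]).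
exists l. split; [exact HSl|]. intros z' Hz'.
apply Rle_trans with (- s).
- apply (Un_cv_le (fun j => F (x (phi j))) (fun j => - s + / INR (Datatypes.S (phi j)))).
  + apply evt_all. intros j. left. apply Hx.
  + apply HF; auto. intros j. apply Hx.
  + replace (- s) with (- s + 0) at 1 by ring. apply CV_plus; [apply Un_cv_const|].
    exact (Un_cv_extraction phi _ _ Hphi Un_cv_inv_S).
- assert (- F z' <= s) by (apply Hub; now exists z'). lra.
Qed.

Lemma eclosed_cv (S : T -> Prop) x l : eclosed_set S -> evt (fun j => S (x j)) -> cv x l -> S l.
Proof.
intros HS E H. apply HS. intros e He.
destruct (evt_and _ _ E (evt_near _ _ _ H He)) as [N HN].
exists (x N). now apply HN.
Qed.

End Seq.

(** A finite-dimensional Banach-Steinhaus argument: expanding [L j (x j [-] l)] along the frame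
    gives coefficients tending to 0 times convergent vectors. Linearity is eventual since
    derivatives are known to exist only near the base point. *)
Lemma lin_cv {T U} `{EucLaws T} `{EucLaws U} (L : nat -> T -> U) (L0 : T -> U) x l :
  evt (fun j => linear_map (L j)) -> (forall w, cv (fun j => L j w) (L0 w)) ->
  cv x l -> cv (fun j => L j (x j)) (L0 l).
Proof.
intros HL Hw Hx. apply cv_shift.
apply (cv_ext (fun j => L j (x j [-] l) [+] (L j l [-] L0 l))).
{ revert HL. apply evt_mono. intros j HL. rewrite (lin_sub _ HL). vec. }
replace (ezero : U) with ((ezero : U) [+] ezero) by vec.
apply cv_add; [|now apply -> cv_shift].
destruct (finite_basis (T := T)) as [bs Hbs].
apply (cv_ext (fun j => L j (comb bs (x j [-] l)))).
{ apply evt_all. intros j. now rewrite Hbs. }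
clear Hbs. induction bs as [|b bs IH].
- apply (cv_ext (fun _ => ezero)); [|apply cv_const].
  revert HL. apply evt_mono. intros j HL. cbn. now rewrite (lin_0 _ HL).
- apply (cv_ext (fun j => einner (x j [-] l) b [*] L j b [+] L j (comb bs (x j [-] l)))).
  { revert HL. apply evt_mono. intros j HL. cbn. fold (comb bs (x j [-] l)).
    now rewrite (lin_add _ HL), (lin_scal _ HL). }
  replace (ezero : U) with (0 [*] L0 b [+] ezero) by vec.
  apply cv_add; [|exact IH]. apply cv_scal; [|apply Hw].
  rewrite <- (inner_0l b). apply cv_inner_const, (proj1 (cv_shift x l)), Hx.
Qed.

Lemma lin_cv_const {T U} `{EucLaws T} `{EucLaws U} (A : T -> U) x l :
  linear_map A -> cv x l -> cv (fun j => A (x j)) (A l).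
Proof.
intros HA. apply (lin_cv (fun _ => A)); [now apply evt_all|]. intros w. apply cv_const.
Qed.

Lemma cv_pair {T U} `{EucLaws T} `{EucLaws U} (x : nat -> T) (y : nat -> U) a b :
  cv x a -> cv y b -> cv (fun j => (x j, y j)) (a, b).
Proof.
intros Hx Hy. apply cv_weak. intros [w w']. cbn. apply CV_plus; now apply cv_inner_const.
Qed.

Lemma cv_fst {T U} `{EucLaws T} `{EucLaws U} (z : nat -> T * U) a :
  cv z a -> cv (fun j => fst (z j)) (fst a).
Proof. apply lin_cv_const. now split. Qed.

Lemma cv_snd {T U} `{EucLaws T} `{EucLaws U} (z : nat -> T * U) a :
  cv z a -> cv (fun j => snd (z j)) (snd a).
Proof. apply lin_cv_const. now split. Qed.

(** * Derivatives *)

Definition null_seq (t : nat -> R) := (forall j, 0 < t j) /\ Un_cv t 0.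

Lemma null_seq_inv_S : null_seq (fun j => / INR (S j)).
Proof. split; [exact inv_INR_S_pos|exact Un_cv_inv_S]. Qed.

Section Derivative.
Context {T U : Type} {HT : Euc T} {LT : EucLaws T} {HU : Euc U} {LU : EucLaws U}.
Implicit Types (F : T -> U) (z : T) (A : T -> U).

(** The directions are merely bounded: in the second differences below they involve intermediate
    points of a mean value theorem, which need not converge. *)
Lemma fderiv_remainder F z A t y M : is_fderiv F z A -> null_seq t ->
  evt (fun j => enorm (y j) <= M) ->
  cv (fun j => / t j [*] (F (z [+] t j [*] y j) [-] F z [-] t j [*] A (y j))) ezero.
Proof.
intros [HA HF] [Ht Ht0] HM. apply cv_enorm0, Un_cv_of_evt. intros e He.
assert (HM0 : 0 <= M).
{ destruct HM as [N HN]. specialize (HN N (le_n _)). pose proof (enorm_ge0 (y N)). lra. }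
(* [M + 1] avoids division by zero and the factor 1/2 makes the final inequality strict. *)
destruct (HF (e / (M + 1) / 2)) as [del [Hdel HF']].
{ apply Rdiv_lt_0_compat; [apply Rdiv_lt_0_compat|]; lra. }
assert (Hd : 0 < del / (M + 1)) by (apply Rdiv_lt_0_compat; lra).
generalize (evt_and _ _ HM (evt_lt _ _ _ Ht0 Hd)). apply evt_mono. intros j [Hj Hj'].
specialize (Ht j). rewrite !Rminus_0_r in *. rewrite (Rabs_right (t j)) in Hj' by lra.
rewrite Rabs_right by (apply Rle_ge, enorm_ge0).
rewrite enorm_scal, Rabs_right by (left; now apply Rinv_0_lt_compat).
assert (Hw : enorm (t j [*] y j) <= t j * M).
{ rewrite enorm_scal, Rabs_right by lra. apply Rmult_le_compat_l; lra. }
assert (t j * (M + 1) < del).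
{ apply (Rmult_lt_compat_r (M + 1)) in Hj'; [|lra]. unfold Rdiv in Hj'.
  rewrite Rmult_assoc, Rinv_l in Hj'; lra. }
specialize (HF' (t j [*] y j)). rewrite (lin_scal _ HA) in HF'.
apply Rle_lt_trans with (/ t j * (e / (M + 1) / 2 * (t j * M))).
- apply Rmult_le_compat_l; [left; now apply Rinv_0_lt_compat|].
  eapply Rle_trans; [apply HF'; nra|]. apply Rmult_le_compat_l; [|exact Hw].
  left. apply Rdiv_lt_0_compat; [apply Rdiv_lt_0_compat|]; lra.
- replace (/ t j * (e / (M + 1) / 2 * (t j * M))) with (e * (M / (M + 1) / 2)) by (field; lra).
  assert (M / (M + 1) <= 1).
  { apply (Rmult_le_reg_r (M + 1)); [lra|]. unfold Rdiv. rewrite Rmult_assoc, Rinv_l; lra. }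
  nra.
Qed.

Lemma fderiv_hadamard F z A t y l : is_fderiv F z A -> null_seq t -> cv y l ->
  cv (fun j => / t j [*] (F (z [+] t j [*] y j) [-] F z)) (A l).
Proof.
intros HF Ht Hy.
apply (cv_eq (fun j => / t j [*] (F (z [+] t j [*] y j) [-] F z [-] t j [*] A (y j))
               [+] A (y j)) _ (ezero [+] A l)); [|vec|].
{ intros j. vec. field. destruct Ht as [Ht _]. specialize (Ht j). lra. }
apply cv_add.
- apply (fderiv_remainder F z A t y (enorm l + 1) HF Ht). now apply evt_bounded.
- apply lin_cv_const; [apply HF|exact Hy].
Qed.

Lemma fderiv_unique F z A B w : is_fderiv F z A -> is_fderiv F z B -> A w = B w.
Proof.
intros HA HB.
eapply cv_unique; eapply fderiv_hadamard; eauto using null_seq_inv_S; apply cv_const.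
Qed.

Lemma fderiv_correct F z : (exists A, is_fderiv F z A) -> is_fderiv F z (fderiv F z).
Proof. intros H. unfold fderiv. now apply epsilon_spec. Qed.

Lemma fderiv_eq F z A w : is_fderiv F z A -> fderiv F z w = A w.
Proof.
intros H. apply (fderiv_unique F z); [|exact H]. apply fderiv_correct. now exists A.
Qed.

(** In finite dimension the Hadamard property implies the Frechet one: normalise vectors violating
    the estimate and extract a convergent direction. Differentiation rules can then be proved as
    limits of quotients along sequences. *)
Lemma hadamard_fderiv F z A : linear_map A ->
  (forall t y l, null_seq t -> cv y l ->
     cv (fun j => / t j [*] (F (z [+] t j [*] y j) [-] F z)) (A l)) ->
  is_fderiv F z A.
Proof.
intros HA H. split; [exact HA|]. intros e He. apply NNPP. intros N.
assert (Hw : forall j, exists w, enorm w < / INR (S j) /\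
          e * enorm w < enorm (F (z [+] w) [-] F z [-] A w)).
{ intros j. apply NNPP. intros M. apply N. exists (/ INR (S j)).
  split; [apply inv_INR_S_pos|]. intros w Hw. apply Rnot_lt_le. intros C. apply M.
  now exists w. }
apply choice in Hw as [w Hw].
assert (Hpos : forall j, 0 < enorm (w j)).
{ intros j. destruct (Rle_lt_or_eq_dec _ _ (enorm_ge0 (w j))) as [|E]; [assumption|].
  exfalso. destruct (Hw j) as [_ C]. symmetry in E. apply enorm_eq0 in E.
  rewrite E, (lin_0 _ HA), enorm_0 in C.
  replace (F (z [+] ezero) [-] F z [-] ezero) with (ezero : U) in C.
  - rewrite enorm_0 in C. lra.
  - replace (z [+] ezero) with z by vec. vec. }
destruct (bolzano_weierstrass (fun j => / enorm (w j) [*] w j) 1) as (phi & l & Hphi & Hl).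
{ intros j. specialize (Hpos j). rewrite enorm_scal, Rabs_right.
  - rewrite Rinv_l; lra.
  - left. now apply Rinv_0_lt_compat. }
set (t := fun j => enorm (w (phi j))).
assert (Ht : null_seq t).
{ split; [intros j; apply Hpos|].
  apply (Un_cv_squeeze _ (fun j => / INR (S (phi j)))).
  - apply evt_all. intros j. unfold t. rewrite Rabs_right by (apply Rle_ge, enorm_ge0).
    left. apply Hw.
  - exact (Un_cv_extraction phi _ _ Hphi Un_cv_inv_S). }
pose proof (cv_sub _ _ _ _ (H t _ l Ht Hl) (lin_cv_const A _ _ HA Hl)) as C.
apply cv_enorm in C. rewrite vsub_diag, enorm_0 in C.
assert (e <= 0); [|lra].
eapply (Un_cv_le (fun _ => e)); [|apply Un_cv_const|exact C].
apply evt_all. intros j. cbn beta. unfold t. destruct (Hw (phi j)) as [_ C'].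
specialize (Hpos (phi j)). set (r := enorm (w (phi j))) in *.
replace (r [*] (/ r [*] w (phi j))) with (w (phi j)) by (vec; field; lra).
rewrite (lin_scal _ HA).
replace (/ r [*] (F (z [+] w (phi j)) [-] F z) [-] / r [*] A (w (phi j)))
  with (/ r [*] (F (z [+] w (phi j)) [-] F z [-] A (w (phi j)))) by vec.
rewrite enorm_scal, Rabs_right by (left; now apply Rinv_0_lt_compat).
apply (Rmult_le_reg_l r); [exact Hpos|]. rewrite <- Rmult_assoc, Rinv_r by lra. lra.
Qed.

Lemma is_fderiv_local F F' z A d : 0 < d -> is_fderiv F z A ->
  (forall z', enorm (z' [-] z) < d -> F' z' = F z') -> is_fderiv F' z A.
Proof.
intros Hd [HA HF] E. split; [exact HA|]. intros e He.
destruct (HF e He) as [del [Hdel H]]. exists (Rmin d del).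
split; [now apply Rmin_glb_lt|]. intros w Hw.
rewrite !E.
- apply H. eapply Rlt_le_trans; [exact Hw|apply Rmin_r].
- rewrite vsub_diag, enorm_0. exact Hd.
- rewrite vsub_add. eapply Rlt_le_trans; [exact Hw|apply Rmin_l].
Qed.

Lemma fderiv_continuous F z A x : is_fderiv F z A -> cv x z -> cv (fun j => F (x j)) (F z).
Proof.
intros [HA HF] Hx. apply cv_shift.
destruct (lin_bounded _ HA) as [c [Hc HcA]].
destruct (HF 1 Rlt_0_1) as [del [Hdel H]].
apply (cv_squeeze _ (fun j => (1 + c) * enorm (x j [-] z))).
- generalize (evt_near _ _ _ Hx Hdel). apply evt_mono. intros j Hj.
  specialize (H _ Hj). rewrite add_vsub in H.
  pose proof (enorm_le_add (F (x j) [-] F z) (A (x j [-] z))).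
  specialize (HcA (x j [-] z)). lra.
- replace 0 with ((1 + c) * 0) by ring. apply CV_mult; [apply Un_cv_const|exact Hx].
Qed.

End Derivative.

Lemma is_fderiv_inner {T U} `{EucLaws T} `{EucLaws U} (F : T -> U) z A b : is_fderiv F z A ->
  is_fderiv (fun x => einner b (F x)) z (fun w => einner b (A w)).
Proof.
intros HF. apply hadamard_fderiv; [apply linear_inner, HF|].
intros t y l Ht Hy.
pose proof (fderiv_hadamard F z A t y l HF Ht Hy) as C.
apply (cv_inner_const _ _ b) in C. apply cv_weak. intros w. cbn.
apply (Un_cv_evt_eq (fun j => einner (/ t j [*] (F (z [+] t j [*] y j) [-] F z)) b * w)).
- apply evt_all. intros j. inner_simpl. rewrite !(inner_sym b). unfold vsub. cbn. ring.
- rewrite inner_sym in C. apply CV_mult; [exact C|apply Un_cv_const].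
Qed.

Lemma is_fderiv_comp {T U W} `{EucLaws T} `{EucLaws U} `{EucLaws W}
  (g : T -> U) (h : U -> W) z A B :
  is_fderiv g z A -> is_fderiv h (g z) B -> is_fderiv (fun x => h (g x)) z (fun w => B (A w)).
Proof.
intros Hg Hh. apply hadamard_fderiv; [apply linear_comp; [apply Hg|apply Hh]|].
intros t y l Ht Hy.
pose proof (fderiv_hadamard _ _ _ _ _ _ Hg Ht Hy) as C.
pose proof (fderiv_hadamard _ _ _ _ _ _ Hh Ht C) as D.
revert D. apply cv_eq; [|reflexivity]. intros j. cbn beta. do 3 f_equal.
destruct Ht as [Ht _]. specialize (Ht j). vec. field. lra.
Qed.

Lemma enorm_R (x : R) : enorm x = Rabs x.
Proof. apply sqrt_Rsqr_abs. Qed.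

(** The bridge to one-variable calculus, through which [MVT_cor2] applies on segments. *)
Lemma derivable_along {T} `{EucLaws T} (F : T -> R) z v s A :
  is_fderiv F (z [+] s [*] v) A -> derivable_pt_lim (fun r => F (z [+] r [*] v)) s (A v).
Proof.
intros [HA HF] e He. pose proof (enorm_ge0 v) as Hv.
destruct (HF (e / (enorm v + 1) / 2)) as [del [Hdel H0']].
{ apply Rdiv_lt_0_compat; [apply Rdiv_lt_0_compat|]; lra. }
assert (Hd : 0 < del / (enorm v + 1)) by (apply Rdiv_lt_0_compat; lra).
exists (mkposreal _ Hd). intros r Hr0 Hr. cbn [pos] in Hr.
assert (Hn : enorm (r [*] v) = Rabs r * enorm v) by apply enorm_scal.
pose proof (Rabs_pos_lt r Hr0) as Hrp.
specialize (H0' (r [*] v)). rewrite (lin_scal _ HA), Hn in H0'.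
replace (z [+] s [*] v [+] r [*] v) with (z [+] (s + r) [*] v) in H0' by vec.
assert (Rabs r * (enorm v + 1) < del).
{ apply (Rmult_lt_compat_r (enorm v + 1)) in Hr; [|lra]. unfold Rdiv in Hr.
  rewrite Rmult_assoc, Rinv_l in Hr; lra. }
assert (Hb : Rabs r * enorm v < del) by nra. specialize (H0' Hb).
rewrite enorm_R in H0'. unfold vsub in H0'. cbn in H0'.
match type of H0' with Rabs ?x <= _ => set (q := x) in * end.
replace ((F (z [+] (s + r) [*] v) - F (z [+] s [*] v)) / r - A v) with (q / r)
  by (unfold q; field; exact Hr0).
unfold Rdiv at 1. rewrite Rabs_mult, Rabs_inv.
apply (Rmult_lt_reg_r (Rabs r)); [exact Hrp|].
rewrite Rmult_assoc, Rinv_l by lra. rewrite Rmult_1_r.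
eapply Rle_lt_trans; [exact H0'|].
replace (e / (enorm v + 1) / 2 * (Rabs r * enorm v))
  with (e * Rabs r * (enorm v / (enorm v + 1) / 2)) by (field; lra).
assert (enorm v / (enorm v + 1) <= 1).
{ apply (Rmult_le_reg_r (enorm v + 1)); [lra|]. unfold Rdiv. rewrite Rmult_assoc, Rinv_l; lra. }
assert (0 < e * Rabs r) by nra. nra.
Qed.

(** * Second-order expansions *)

(** The first derivative is an explicit field [G'] instead of [fderiv G], so that a composition can
    carry its chain-rule formula. [D v w] differentiates [G' _ w] in the direction [v]; the order of
    the arguments matters until [schwarz]. *)
Definition twice_fderiv {T U} `{Euc T} `{Euc U}
  (G : T -> U) (G' : T -> T -> U) (D : T -> T -> U) (z : T) (del : R) : Prop :=
  0 < del /\ (forall x, enorm (x [-] z) < del -> is_fderiv G x (G' x)) /\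
  forall w, is_fderiv (fun x => G' x w) z (fun v => D v w).

Lemma C2_twice_fderiv {T U} `{EucLaws T} `{EucLaws U} (F : T -> U) z del :
  0 < del -> C2_on F z del -> twice_fderiv F (fderiv F) (fderiv2 F z) z del.
Proof.
intros Hd [[HF _] HF2]. split; [exact Hd|]. split.
- intros x Hx. now apply fderiv_correct, HF.
- intros w. apply fderiv_correct. apply (HF2 w). now rewrite vsub_diag, enorm_0.
Qed.

Lemma null_seq_near {T} `{EucLaws T} (z : T) t y l : null_seq t -> cv y l ->
  cv (fun j => z [+] t j [*] y j) z.
Proof.
intros [_ Ht] Hy.
apply (cv_eq (fun j => z [+] t j [*] y j) _ (z [+] 0 [*] l)); [reflexivity|vec|].
apply cv_add; [apply cv_const|now apply cv_scal].
Qed.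

Section Twice.
Context {T U : Type} {HT : Euc T} {LT : EucLaws T} {HU : Euc U} {LU : EucLaws U}.
Variables (G : T -> U) (G' D : T -> T -> U) (z : T) (del : R).
Hypothesis HG : twice_fderiv G G' D z del.

(** Near [z] the quotients are linear in the last argument and converge pointwise in it, so [lin_cv]
    lets that argument move too. *)
Lemma fderiv_quotient t y x l m : null_seq t -> cv y l -> cv x m ->
  cv (fun j => / t j [*] (G' (z [+] t j [*] y j) (x j) [-] G' z (x j))) (D l m).
Proof.
intros Ht Hy Hx. destruct HG as [Hd [H1 H2]].
apply (lin_cv (fun j w => / t j [*] (G' (z [+] t j [*] y j) w [-] G' z w)) (fun w => D l w));
  [| |exact Hx].
- generalize (evt_near _ _ _ (null_seq_near z t y l Ht Hy) Hd). apply evt_mono. intros j Hj.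
  destruct (H1 _ Hj) as [HL _].
  destruct (H1 z) as [HL0 _]; [now rewrite vsub_diag, enorm_0|].
  split; intros.
  + rewrite (lin_add _ HL), (lin_add _ HL0). vec.
  + rewrite (lin_scal _ HL), (lin_scal _ HL0). vec.
- intros w. exact (fderiv_hadamard _ _ _ _ _ _ (H2 w) Ht Hy).
Qed.

(** Rolle's argument: [c] is chosen so that subtracting [s * einner (G' z v) b + s * s * c] from [s
    |-> einner b (G (z [+] s [*] v))] equalises the values at 0 and 1. *)
Lemma taylor_rolle v b : enorm v < del -> exists s, 0 < s < 1 /\
  einner (G (z [+] v) [-] G z [-] G' z v) b * (2 * s) =
  einner (G' (z [+] s [*] v) v [-] G' z v) b.
Proof.
intros Hv. destruct HG as [Hd [H1 _]].
set (c := einner (G (z [+] v) [-] G z [-] G' z v) b).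
destruct (MVT_cor2
  (fun s => einner b (G (z [+] s [*] v)) + - (s * (einner (G' z v) b) + (s * s) * c))
  (fun s => einner b (G' (z [+] s [*] v) v)
            + - ((1 * (einner (G' z v) b) + s * 0) + ((1 * s + s * 1) * c + (s * s) * 0)))
  0 1 Rlt_0_1) as [s [E Hs]].
{ intros s Hs.
  assert (Hn : enorm (z [+] s [*] v [-] z) < del).
  { rewrite vsub_add, enorm_scal, Rabs_right by lra. pose proof (enorm_ge0 v). nra. }
  apply (derivable_pt_lim_plus (fun s => einner b (G (z [+] s [*] v)))
    (fun s => - (s * (einner (G' z v) b) + (s * s) * c))).
  { apply (derivable_along (fun x => einner b (G x)) z v s (fun w => einner b (G' (z [+] s [*] v) w))).
    now apply is_fderiv_inner, H1. }
  apply (derivable_pt_lim_opp (fun s => s * (einner (G' z v) b) + (s * s) * c)).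
  apply (derivable_pt_lim_plus (fun s => s * (einner (G' z v) b)) (fun s => (s * s) * c)).
  - apply (derivable_pt_lim_mult (fun s => s) (fun _ => einner (G' z v) b));
      [apply derivable_pt_lim_id|apply derivable_pt_lim_const].
  - apply (derivable_pt_lim_mult (fun s => s * s) (fun _ => c));
      [|apply derivable_pt_lim_const].
    apply (derivable_pt_lim_mult (fun s => s) (fun s => s)); apply derivable_pt_lim_id. }
exists s. split; [lra|].
replace (z [+] 1 [*] v) with (z [+] v) in E by vec.
replace (z [+] 0 [*] v) with z in E by vec.
assert (Ec : c = einner b (G (z [+] v)) - einner b (G z) - einner (G' z v) b).
{ unfold c. inner_simpl. rewrite !(inner_sym b). ring. }
inner_simpl. rewrite (inner_sym (G' _ _) b) at 1. lra.
Qed.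

(** The Rolle point [s j] depends on the test vector [b], hence the weak formulation. Since
    [s j * t j] is again a null sequence, [fderiv_quotient] applies with that step; the factor
    [2 * s j] then cancels [s j] and leaves 1/2. *)
Lemma taylor_second_order t y l : null_seq t -> cv y l ->
  cv (fun j => / (t j * t j) [*] (G (z [+] t j [*] y j) [-] G z [-] t j [*] G' z (y j)))
     (/ 2 [*] D l l).
Proof.
intros Ht Hy. apply cv_weak. intros b. destruct HG as [Hd [H1 H2]].
assert (Hz : linear_map (G' z)) by (apply H1; now rewrite vsub_diag, enorm_0).
assert (Hs : forall j, exists s, 0 < s < 1 /\ (enorm (t j [*] y j) < del ->
  einner (G (z [+] t j [*] y j) [-] G z [-] G' z (t j [*] y j)) b * (2 * s) =
  einner (G' (z [+] s [*] (t j [*] y j)) (t j [*] y j) [-] G' z (t j [*] y j)) b)).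
{ intros j. destruct (Rlt_dec (enorm (t j [*] y j)) del) as [L|L].
  - destruct (taylor_rolle _ b L) as [s [Hs E]]. now exists s.
  (* A default for the finitely many indices at which the increment leaves the ball. *)
  - exists (1 / 2). split; [lra|]. contradiction. }
apply choice in Hs as [s Hs].
assert (Hst : null_seq (fun j => s j * t j)).
{ destruct Ht as [Ht Ht0]. split.
  - intros j. apply Rmult_lt_0_compat; [apply Hs|apply Ht].
  - apply (Un_cv_squeeze _ t); [|exact Ht0]. apply evt_all. intros j.
    specialize (Ht j). destruct (Hs j) as [Hs' _]. rewrite Rabs_right; nra. }
pose proof (cv_inner_const _ _ b (fderiv_quotient _ _ _ _ _ Hst Hy Hy)) as C.
rewrite inner_scall.
eapply Un_cv_evt_eq; [|exact (CV_mult _ _ _ _ (Un_cv_const (/ 2)) C)].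
generalize (evt_and _ _ (evt_near _ _ _ (null_seq_near z t y l Ht Hy) Hd)
              (evt_near _ _ _ (null_seq_near z _ y l Hst Hy) Hd)).
apply evt_mono. intros j [Hj Hj']. cbn beta.
destruct (H1 _ Hj') as [HL _]. rewrite vsub_add in Hj.
destruct (Hs j) as [Hs0 E]. specialize (E Hj).
replace (s j [*] (t j [*] y j)) with ((s j * t j) [*] y j) in E by vec.
rewrite !(lin_scal _ HL), !(lin_scal _ Hz) in E.
rewrite !inner_scall. destruct Ht as [Ht _]. specialize (Ht j).
set (c := einner (G _ [-] _ [-] _) b) in *.
replace (t j [*] G' (z [+] (s j * t j) [*] y j) (y j) [-] t j [*] G' z (y j))
  with (t j [*] (G' (z [+] (s j * t j) [*] y j) (y j) [-] G' z (y j))) in E by vec.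
rewrite inner_scall in E. set (e := einner (G' (z [+] (s j * t j) [*] y j) (y j) [-] G' z (y j)) b) in *.
assert (e = c * (2 * s j) / t j) as -> by (apply (Rmult_eq_reg_l (t j)); [rewrite <- E; field|]; lra).
field. lra.
Qed.

(** The mean value theorem is applied to the difference of [G] along two parallel segments in the
    direction [w]. Writing their base points with [t * 1] and [t * 0] lets the single bound [Hn]
    cover both. *)
Lemma second_difference v w b t : 0 < t -> t * (enorm v + enorm w) < del -> exists s, 0 < s < 1 /\
  einner (G (z [+] t [*] (v [+] w)) [-] G (z [+] t [*] w) [-] G (z [+] t [*] v) [+] G z) b
  = t * einner (G' (z [+] t [*] (v [+] s [*] w)) w [-] G' (z [+] t [*] (s [*] w)) w) b.
Proof.
intros Ht Hd. destruct HG as [_ [H1 _]].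
pose proof (enorm_ge0 v). pose proof (enorm_ge0 w).
assert (Hn : forall a r, 0 <= a <= 1 -> 0 <= r <= 1 ->
  enorm (z [+] (t * a) [*] v [+] r [*] (t [*] w) [-] z) < del).
{ intros a r Ha Hr.
  replace (z [+] (t * a) [*] v [+] r [*] (t [*] w) [-] z) with (t [*] (a [*] v [+] r [*] w)) by vec.
  rewrite enorm_scal, Rabs_right by lra. eapply Rle_lt_trans; [|exact Hd].
  apply Rmult_le_compat_l; [lra|]. eapply Rle_trans; [apply enorm_add|].
  rewrite !enorm_scal, !Rabs_right by lra. nra. }
destruct (MVT_cor2
  (fun s => einner b (G (z [+] (t * 1) [*] v [+] s [*] (t [*] w)))
            - einner b (G (z [+] (t * 0) [*] v [+] s [*] (t [*] w))))
  (fun s => einner b (G' (z [+] (t * 1) [*] v [+] s [*] (t [*] w)) (t [*] w))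
            - einner b (G' (z [+] (t * 0) [*] v [+] s [*] (t [*] w)) (t [*] w)))
  0 1 Rlt_0_1) as [s [E Hs]].
{ intros s Hs.
  apply (derivable_pt_lim_minus (fun s => einner b (G (z [+] (t * 1) [*] v [+] s [*] (t [*] w))))
    (fun s => einner b (G (z [+] (t * 0) [*] v [+] s [*] (t [*] w)))));
  apply (derivable_along (fun x => einner b (G x)) _ (t [*] w) s
    (fun w => einner b (G' _ w)));
  apply is_fderiv_inner, H1, Hn; lra. }
exists s. split; [lra|].
assert (L1 : linear_map (G' (z [+] (t * 1) [*] v [+] s [*] (t [*] w)))) by (apply H1, Hn; lra).
assert (L0 : linear_map (G' (z [+] (t * 0) [*] v [+] s [*] (t [*] w)))) by (apply H1, Hn; lra).
rewrite (lin_scal _ L1), (lin_scal _ L0) in E.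
replace (z [+] (t * 1) [*] v [+] s [*] (t [*] w)) with (z [+] t [*] (v [+] s [*] w)) in E by vec.
replace (z [+] (t * 0) [*] v [+] s [*] (t [*] w)) with (z [+] t [*] (s [*] w)) in E by vec.
replace (z [+] (t * 1) [*] v [+] 1 [*] (t [*] w)) with (z [+] t [*] (v [+] w)) in E by vec.
replace (z [+] (t * 0) [*] v [+] 1 [*] (t [*] w)) with (z [+] t [*] w) in E by vec.
replace (z [+] (t * 1) [*] v [+] 0 [*] (t [*] w)) with (z [+] t [*] v) in E by vec.
replace (z [+] (t * 0) [*] v [+] 0 [*] (t [*] w)) with z in E by vec.
rewrite !inner_scalr, !(inner_sym b) in E. inner_simpl. lra.
Qed.

(** Expand [G' _ w] at [z] in the directions [v [+] s j [*] w] and [s j [*] w]: the terms in [s j]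
    cancel by linearity, so the intermediate points disappear and [D v w] remains. *)
Lemma second_difference_cv v w b :
  Un_cv (fun j => let t := / INR (S j) in
    einner (G (z [+] t [*] (v [+] w)) [-] G (z [+] t [*] w) [-] G (z [+] t [*] v) [+] G z) b
    / (t * t)) (einner (D v w) b).
Proof.
set (t := fun j => / INR (S j)). assert (Ht : null_seq t) by exact null_seq_inv_S.
destruct HG as [Hd [_ H2]].
assert (Hs : forall j, exists s, 0 < s < 1 /\ (t j * (enorm v + enorm w) < del ->
  einner (G (z [+] t j [*] (v [+] w)) [-] G (z [+] t j [*] w) [-] G (z [+] t j [*] v) [+] G z) b
  = t j * einner (G' (z [+] t j [*] (v [+] s [*] w)) w [-] G' (z [+] t j [*] (s [*] w)) w) b)).
{ intros j. destruct (Rlt_dec (t j * (enorm v + enorm w)) del) as [L|L].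
  - destruct (second_difference v w b (t j) (proj1 Ht j) L) as [s [Hs E]]. now exists s.
  - exists (1 / 2). split; [lra|]. contradiction. }
apply choice in Hs as [s Hs].
assert (Hsw : forall j, enorm (s j [*] w) <= enorm w).
{ intros j. destruct (Hs j) as [Hj _]. rewrite enorm_scal, Rabs_right by lra.
  pose proof (enorm_ge0 w). nra. }
assert (R1 := fderiv_remainder _ _ _ t (fun j => v [+] s j [*] w) (enorm v + enorm w) (H2 w) Ht).
assert (R0 := fderiv_remainder _ _ _ t (fun j => s j [*] w) (enorm w) (H2 w) Ht).
assert (C := cv_sub _ _ _ _ (R1 ltac:(apply evt_all; intros j; eapply Rle_trans;
  [apply enorm_add|specialize (Hsw j); lra])) (R0 ltac:(now apply evt_all))).
apply (cv_inner_const _ _ b) in C.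
replace (einner (D v w) b) with (einner ((ezero : U) [-] ezero) b + einner (D v w) b)
  by (inner_simpl; ring).
eapply Un_cv_evt_eq; [|exact (CV_plus _ _ _ _ C (Un_cv_const _))].
assert (Hdw : 0 < del / (enorm v + enorm w + 1)).
{ pose proof (enorm_ge0 v). pose proof (enorm_ge0 w). apply Rdiv_lt_0_compat; lra. }
generalize (evt_lt _ _ _ (proj2 Ht) Hdw). apply evt_mono. intros j Hj.
destruct Ht as [Ht _]. specialize (Ht j). rewrite Rminus_0_r, Rabs_right in Hj by lra.
cbv zeta. change (/ INR (S j)) with (t j). destruct (Hs j) as [Hs0 ->].
- rewrite (lin_add _ (proj1 (H2 w))). inner_simpl. field. lra.
- pose proof (enorm_ge0 v). pose proof (enorm_ge0 w).
  apply (Rmult_lt_compat_r (enorm v + enorm w + 1)) in Hj; [|lra].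
  unfold Rdiv in Hj. rewrite Rmult_assoc, Rinv_l in Hj; lra.
Qed.

(** The second difference is symmetric in [v] and [w], hence so is its limit. *)
Lemma schwarz v w : D v w = D w v.
Proof.
apply inner_ext. intros b. eapply UL_sequence; [apply second_difference_cv|].
generalize (second_difference_cv w v b). apply Un_cv_evt_eq, evt_all. intros j. cbv zeta.
replace (w [+] v) with (v [+] w) by vec. f_equal. inner_simpl. ring.
Qed.

End Twice.

Lemma fderiv_near {T U} `{EucLaws T} `{EucLaws U} (F : T -> U) z A e :
  is_fderiv F z A -> 0 < e ->
  exists d, 0 < d /\ forall x, enorm (x [-] z) < d -> enorm (F x [-] F z) < e.
Proof.
intros HF He. apply NNPP. intros N.
assert (Hx : forall j, exists x, enorm (x [-] z) < / INR (S j) /\ e <= enorm (F x [-] F z)).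
{ intros j. apply NNPP. intros M. apply N. exists (/ INR (S j)).
  split; [apply inv_INR_S_pos|]. intros x Hx. apply Rnot_le_lt. intros C. apply M. now exists x. }
apply choice in Hx as [x Hx].
assert (Hc : cv x z).
{ apply cv_shift, (cv_squeeze _ (fun j => / INR (S j))); [|exact Un_cv_inv_S].
  apply evt_all. intros j. left. apply Hx. }
destruct (evt_near _ _ _ (fderiv_continuous F z A x HF Hc) He) as [M HM].
specialize (HM M (le_n _)). destruct (Hx M). lra.
Qed.

(** The increment of h'(g x)(g' x w) splits into the change of h' applied to the moving vector g' x
    w, and h'(g z) applied to the change of g' x w. The first part is a [fderiv_quotient] with
    moving last argument. *)
Lemma twice_fderiv_comp {T U W} `{EucLaws T} `{EucLaws U} `{EucLaws W}
  (g : T -> U) g' Dg (h : U -> W) h' Dh z dg dh :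
  twice_fderiv g g' Dg z dg -> twice_fderiv h h' Dh (g z) dh ->
  exists d, d <= dg /\ (forall x, enorm (x [-] z) < d -> enorm (g x [-] g z) < dh) /\
  twice_fderiv (fun x => h (g x)) (fun x w => h' (g x) (g' x w))
    (fun v w => Dh (g' z v) (g' z w) [+] h' (g z) (Dg v w)) z d.
Proof.
intros Hg Hh. pose proof Hg as [Hdg [Hg1 Hg2]]. pose proof Hh as [Hdh [Hh1 Hh2]].
assert (Hz : enorm (z [-] z) < dg) by now rewrite vsub_diag, enorm_0.
assert (Hgz : is_fderiv h (g z) (h' (g z))) by (apply Hh1; now rewrite vsub_diag, enorm_0).
destruct (fderiv_near _ _ _ dh (Hg1 z Hz) Hdh) as [d [Hd Hnear]].
assert (HN : forall x, enorm (x [-] z) < Rmin dg d -> enorm (g x [-] g z) < dh).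
{ intros x Hx. apply Hnear. eapply Rlt_le_trans; [exact Hx|apply Rmin_r]. }
exists (Rmin dg d). split; [apply Rmin_l|]. split; [exact HN|]. split; [now apply Rmin_glb_lt|].
split.
- intros x Hx. apply (is_fderiv_comp g h x (g' x) (h' (g x))).
  + apply Hg1. eapply Rlt_le_trans; [exact Hx|apply Rmin_l].
  + now apply Hh1, HN.
- intros w. apply hadamard_fderiv.
  + split; intros.
    * rewrite (lin_add _ (proj1 (Hg1 z Hz))), (lin_add _ (proj1 (Hh2 _))),
        (lin_add _ (proj1 (Hg2 w))), (lin_add _ (proj1 Hgz)). vec.
    * rewrite (lin_scal _ (proj1 (Hg1 z Hz))), (lin_scal _ (proj1 (Hh2 _))),
        (lin_scal _ (proj1 (Hg2 w))), (lin_scal _ (proj1 Hgz)). vec.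
  + intros t y l Ht Hy.
    pose proof (fderiv_hadamard _ _ _ _ _ _ (Hg1 z Hz) Ht Hy) as C1.
    pose proof (fderiv_hadamard _ _ _ _ _ _ (Hg2 w) Ht Hy) as C2.
    pose proof (fderiv_continuous _ _ _ _ (Hg2 w) (null_seq_near z t y l Ht Hy)) as C3.
    pose proof (fderiv_quotient _ _ _ _ _ Hh _ _ _ _ _ Ht C1 C3) as C4.
    pose proof (lin_cv_const _ _ _ (proj1 Hgz) C2) as C5.
    pose proof (cv_add _ _ _ _ C4 C5) as C. revert C. apply cv_eq; [|reflexivity].
    intros j. cbn beta. destruct Ht as [Ht _]. specialize (Ht j).
    rewrite (lin_scal _ (proj1 Hgz)), (lin_sub _ (proj1 Hgz)).
    replace (g z [+] t j [*] (/ t j [*] (g (z [+] t j [*] y j) [-] g z)))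
      with (g (z [+] t j [*] y j)) by (vec; field; lra).
    vec.
Qed.

(** * Metric regularity and the reduction of normals *)

Lemma closed_ball_cv {T} `{EucLaws T} (c : T) r x l :
  (forall j, enorm (x j [-] c) <= r) -> cv x l -> enorm (l [-] c) <= r.
Proof.
intros Hx Hl. apply (Un_cv_le (fun j => enorm (x j [-] c)) (fun _ => r)).
- now apply evt_all.
- apply cv_enorm, cv_sub; [exact Hl|apply cv_const].
- apply Un_cv_const.
Qed.

Lemma null_seq_le1 t : null_seq t -> evt (fun j => 0 < t j <= 1).
Proof.
intros [Ht Ht0]. generalize (evt_lt _ _ _ Ht0 Rlt_0_1). apply evt_mono. intros j Hj.
specialize (Ht j). rewrite Rminus_0_r, Rabs_right in Hj; lra.
Qed.

(* The solution of [h y' = e] is found as a minimiser of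
   [|h y' - e| + c |y' - y|] over a closed ball: at a minimiser with residual
   [d <> 0], moving along [- B d] would decrease the objective. *)
Lemma lyusternik {T U} `{EucLaws T} `{EucLaws U} (h : T -> U) h' yb rho B beta :
  0 < rho -> 0 < beta ->
  (forall y, enorm (y [-] yb) < rho -> is_fderiv h y (h' y)) ->
  linear_map B -> (forall e, h' yb (B e) = e) -> (forall e, enorm (B e) <= beta * enorm e) ->
  (forall y w, enorm (y [-] yb) < rho ->
     enorm (h' y w [-] h' yb w) <= / (2 * beta) * enorm w) ->
  forall y e, enorm (y [-] yb) < rho / 2 -> enorm (h y [-] e) < rho / (16 * beta) ->
  exists y', h y' = e /\ enorm (y' [-] y) <= 4 * beta * enorm (h y [-] e).
Proof.
intros Hrho Hbeta Hh HB HhB Hb Hc y e Hy He.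
assert (Hball : forall z, enorm (z [-] y) <= rho / 4 -> enorm (z [-] yb) < rho).
{ intros z Hz. pose proof (enorm_tri z y yb). lra. }
(* With weight 1/(4 beta), a step [- s B d] raises the penalty by at most s|d|/4 and lowers the
   residual by at least s|d|/2 up to o(s). Comparison with [y] itself produces the constant 4
   beta. *)
assert (Hib : 0 < / (4 * beta)) by (apply Rinv_0_lt_compat; lra).
destruct (minimum_attained (fun z => enorm (z [-] y) <= rho / 4)
  (fun z => enorm (h z [-] e) + / (4 * beta) * enorm (z [-] y)) y (enorm y + rho / 4) 0)
  as [z [Hz Hmin]].
{ rewrite vsub_diag, enorm_0. lra. }
{ intros z Hz. pose proof (enorm_le_add z y). lra. }
{ intros x l. apply closed_ball_cv. }
{ intros z _. pose proof (enorm_ge0 (h z [-] e)). pose proof (enorm_ge0 (z [-] y)). nra. }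
{ intros x l Hx Hl Hxl. apply CV_plus.
  - apply cv_enorm, cv_sub; [|apply cv_const].
    exact (fderiv_continuous _ _ _ _ (Hh l (Hball l Hl)) Hxl).
  - apply CV_mult; [apply Un_cv_const|]. apply cv_enorm, cv_sub; [exact Hxl|apply cv_const]. }
assert (Hzy : enorm (z [-] y) <= 4 * beta * enorm (h y [-] e)).
{ assert (E : enorm (y [-] y) <= rho / 4) by (rewrite vsub_diag, enorm_0; lra).
  specialize (Hmin y E). rewrite vsub_diag, enorm_0 in Hmin.
  pose proof (enorm_ge0 (h z [-] e)).
  apply (Rmult_le_reg_l (/ (4 * beta))); [exact Hib|].
  rewrite <- Rmult_assoc, Rinv_l; lra. }
exists z. split; [|exact Hzy].
(* The bound rho/(16 beta) on the residual keeps [z] off the boundary of the ball, so small moves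
   from [z] remain admissible. *)
assert (Hlt : enorm (z [-] y) < rho / 4).
{ eapply Rle_lt_trans; [exact Hzy|].
  replace (rho / 4) with (4 * beta * (rho / (16 * beta))) by (field; lra).
  apply Rmult_lt_compat_l; lra. }
apply vsub_eq0. set (d := h z [-] e) in *.
pose proof (Hh z (Hball z Hz)) as Hdz.
set (w := (-1) [*] B d).
assert (Hw : enorm w <= beta * enorm d).
{ unfold w. rewrite enorm_scal, Rabs_left by lra. specialize (Hb d). lra. }
assert (Herr : enorm (d [+] h' z w) <= enorm d / 2).
{ assert (L : linear_map (h' yb)) by (apply Hh; rewrite vsub_diag, enorm_0; lra).
  replace d with ((-1) [*] h' yb w) at 1.
  2: { unfold w. rewrite (lin_scal _ L), HhB. vec. }
  replace ((-1) [*] h' yb w [+] h' z w) with (h' z w [-] h' yb w) by vec.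
  eapply Rle_trans; [apply Hc; auto|].
  apply Rle_trans with (/ (2 * beta) * (beta * enorm d)).
  - apply Rmult_le_compat_l; [left; apply Rinv_0_lt_compat; lra|exact Hw].
  - right. field. lra. }
pose proof null_seq_inv_S as Ht. set (t := fun j => / INR (S j)) in Ht.
assert (R := fderiv_remainder h z (h' z) t (fun _ => w) (enorm w) Hdz Ht ltac:(apply evt_all; intros; lra)).
apply cv_enorm in R. rewrite enorm_0 in R.
assert (Hfin : enorm d / 4 <= 0); [|pose proof (enorm_ge0 d); lra].
eapply (Un_cv_le (fun _ => enorm d / 4)); [|apply Un_cv_const|exact R].
assert (Hgap : 0 < rho / 4 - enorm (z [-] y)) by lra.
generalize (evt_and _ _ (null_seq_le1 t Ht)
  (evt_near _ _ _ (null_seq_near z t (fun _ => w) w Ht (cv_const w)) Hgap)).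
apply evt_mono. intros j [Hj Hnear]. cbn beta. set (s := t j) in *.
set (rm := / s [*] _).
pose proof (enorm_tri (z [+] s [*] w) z y) as Htri.
assert (HS : enorm (z [+] s [*] w [-] y) <= rho / 4) by lra.
specialize (Hmin _ HS). rewrite vsub_add in Htri, Hnear.
rewrite enorm_scal, Rabs_right in Htri by lra.
assert (H1 : enorm (h (z [+] s [*] w) [-] e) <= s * enorm rm + ((1 - s) * enorm d + s * (enorm d / 2))).
{ replace (h (z [+] s [*] w) [-] e)
    with (s [*] rm [+] ((1 - s) [*] d [+] s [*] (d [+] h' z w)))
    by (unfold rm, d; vec; field; lra).
  eapply Rle_trans; [apply enorm_add|]. rewrite enorm_scal, Rabs_right by lra.
  apply Rplus_le_compat_l. eapply Rle_trans; [apply enorm_add|].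
  rewrite !enorm_scal, !Rabs_right by lra.
  apply Rplus_le_compat_l. apply Rmult_le_compat_l; lra. }
assert (H2 : / (4 * beta) * enorm (z [+] s [*] w [-] y)
             <= / (4 * beta) * enorm (z [-] y) + s * (enorm d / 4)).
{ eapply Rle_trans; [apply Rmult_le_compat_l; [lra|exact Htri]|].
  rewrite Rmult_plus_distr_l, Rplus_comm. apply Rplus_le_compat_l.
  replace (s * (enorm d / 4)) with (/ (4 * beta) * (s * (beta * enorm d))) by (field; lra).
  apply Rmult_le_compat_l; [lra|]. apply Rmult_le_compat_l; lra. }
apply (Rmult_le_reg_l s); [lra|]. fold d in Hmin. lra.
Qed.

(** Continuity of the derivative at [yb] supplies a ball where it is 1/(2 beta)-close to its value
    there, [beta] being a bound for a right inverse. The solution is kept within [rho] because the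
    reduction of [C] to [K] is known only there. *)
Lemma metric_regular {T U} `{EucLaws T} `{EucLaws U} (h : T -> U) yb rho :
  0 < rho -> C1_on h yb rho -> (forall e, exists y, fderiv h yb y = e) ->
  exists r L, 0 < r /\ 0 < L /\
    forall y e, enorm (y [-] yb) < r -> enorm (h y [-] e) < r ->
    exists y', h y' = e /\ enorm (y' [-] yb) < rho /\ enorm (y' [-] y) <= L * enorm (h y [-] e).
Proof.
intros Hrho [Hd Hcont] Hs.
assert (Hyb : enorm (yb [-] yb) < rho) by now rewrite vsub_diag, enorm_0.
assert (Hlin : linear_map (fderiv h yb)) by (apply fderiv_correct, Hd, Hyb).
destruct (surjective_right_inverse _ Hlin Hs) as [B [HB HhB]].
destruct (lin_bounded B HB) as [beta [Hbeta Hb]].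
destruct (Hcont yb Hyb (/ (2 * beta))) as [d [Hdpos Hc]].
{ apply Rinv_0_lt_compat. lra. }
set (rho' := Rmin rho d).
assert (Hrho' : 0 < rho') by (now apply Rmin_glb_lt).
assert (Hr1 : rho' <= rho) by apply Rmin_l. assert (Hr2 : rho' <= d) by apply Rmin_r.
assert (Hq : 0 < rho' / (16 * beta)) by (apply Rdiv_lt_0_compat; lra).
exists (Rmin (rho' / 2) (rho' / (16 * beta))), (4 * beta).
split; [apply Rmin_glb_lt; lra|]. split; [lra|]. intros y e Hy He.
pose proof (Rmin_l (rho' / 2) (rho' / (16 * beta))).
pose proof (Rmin_r (rho' / 2) (rho' / (16 * beta))).
destruct (lyusternik h (fderiv h) yb rho' B beta) with (y := y) (e := e) as [y' [E Hy']];
  auto; try lra.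
- intros z Hz. apply fderiv_correct, Hd. lra.
- intros z w Hz. apply Hc; lra.
- exists y'. split; [exact E|]. split; [|exact Hy'].
  pose proof (enorm_tri y' y yb).
  assert (4 * beta * enorm (h y [-] e) <= 4 * beta * (rho' / (16 * beta))).
  { apply Rmult_le_compat_l; lra. }
  replace (4 * beta * (rho' / (16 * beta))) with (rho' / 4) in * by (field; lra). lra.
Qed.

(** Points within o(t) of the ray suffice. The shift by [N] is due to [tangent_cone], which asks for
    membership at every index. *)
Lemma tangent_approx {T} `{EucLaws T} (Om : T -> Prop) z w t e : null_seq t ->
  evt (fun j => exists x, Om x /\ enorm (x [-] (z [+] t j [*] w)) <= t j * e j) ->
  Un_cv e 0 -> tangent_cone Om z w.
Proof.
intros [Ht Ht0] [N HN] He.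
assert (Hx : forall j, exists x, Om x /\
  enorm (x [-] (z [+] t (N + j)%nat [*] w)) <= t (N + j)%nat * e (N + j)%nat).
{ intros j. apply HN. lia. }
apply choice in Hx as [x Hx].
assert (Hext : extraction (fun j => (N + j)%nat)) by (intros j; lia).
exists (fun j => t (N + j)%nat), (fun j => / t (N + j)%nat [*] (x j [-] z)).
split; [intros j; apply Ht|]. split; [exact (Un_cv_extraction _ _ _ Hext Ht0)|]. split.
- apply (Un_cv_squeeze _ (fun j => e (N + j)%nat)); [|exact (Un_cv_extraction _ _ _ Hext He)].
  apply evt_all. intros j. specialize (Ht (N + j)%nat). destruct (Hx j) as [_ Hj].
  set (s := t (N + j)%nat) in *. rewrite Rabs_right by (apply Rle_ge, enorm_ge0).
  replace (/ s [*] (x j [-] z) [-] w) with (/ s [*] (x j [-] (z [+] s [*] w))) by (vec; field; lra).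
  rewrite enorm_scal, Rabs_right by (left; now apply Rinv_0_lt_compat).
  apply (Rmult_le_reg_l s); [exact Ht|]. rewrite <- Rmult_assoc, Rinv_r; lra.
- intros j. specialize (Ht (N + j)%nat). set (s := t (N + j)%nat) in *.
  replace (z [+] s [*] (/ s [*] (x j [-] z))) with (x j) by (vec; field; lra). apply Hx.
Qed.

Lemma normal_tangent {T} `{EucLaws T} (Om : T -> Prop) z v w :
  rnormal Om z v -> tangent_cone Om z w -> einner v w <= 0.
Proof.
intros [_ Hv] (t & y & Ht & Ht0 & Hy & HOm).
assert (Hnt : null_seq t) by now split.
apply Rnot_lt_le. intros C.
(* Chosen so that [e * enorm w] falls short of a positive [einner v w], also when the norm of [w] is
   small. *)
set (e := einner v w / (2 * (enorm w + 1))).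
pose proof (enorm_ge0 w).
assert (He : 0 < e) by (apply Rdiv_lt_0_compat; lra).
destruct (Hv e He) as [del [Hdel H']].
assert (einner v w <= e * enorm w).
{ apply (Un_cv_le (fun j => einner v (y j)) (fun j => e * enorm (y j))).
  - generalize (evt_near _ _ _ (null_seq_near z t y w Hnt Hy) Hdel). apply evt_mono.
    intros j Hj. specialize (H' _ (HOm j) Hj). specialize (Ht j).
    rewrite vsub_add, inner_scalr, enorm_scal, Rabs_right in H' by lra.
    apply (Rmult_le_reg_l (t j)); [exact Ht|]. lra.
  - apply (cv_inner (fun _ => v) y v w); [apply cv_const|exact Hy].
  - apply CV_mult; [apply Un_cv_const|now apply cv_enorm]. }
assert (E : e * (2 * (enorm w + 1)) = einner v w) by (unfold e; field; lra). nra.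
Qed.

(** * Tangents and normals of [C] through the reduction map *)

Section Reduction.
Context {T E : Type} {HT : Euc T} {LT : EucLaws T} {HE : Euc E} {LE : EucLaws E}.
Variables (C : T -> Prop) (K : E -> Prop) (h : T -> E) (yb : T) (rho : R).
Hypotheses (Hrho : 0 < rho) (Hh : C1_on h yb rho) (Hh0 : h yb = ezero)
  (Hsurj : forall e, exists y, fderiv h yb y = e)
  (HCK : forall y, enorm (y [-] yb) < rho -> (C y <-> K (h y)))
  (HK : closed_convex_cone K).

Lemma fderiv_reduction : is_fderiv h yb (fderiv h yb).
Proof. apply fderiv_correct, Hh. now rewrite vsub_diag, enorm_0. Qed.

(** Along the ray, h(yb + t w) misses t h'(yb) w, a point of [K], by o(t). Metric regularity
    corrects the ray by o(t) so that this point is hit exactly. *)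
Lemma tangent_reduction w : K (fderiv h yb w) -> tangent_cone C yb w.
Proof.
intros Hw. destruct (metric_regular h yb rho Hrho Hh Hsurj) as (r & L & Hr & HL & Hreg).
pose proof null_seq_inv_S as Ht. set (t := fun j => / INR (S j)) in Ht.
assert (R := fderiv_remainder h yb _ t (fun _ => w) (enorm w) fderiv_reduction Ht
  ltac:(apply evt_all; intros; lra)).
set (rm := fun j => _) in R. apply (proj1 (cv_enorm0 rm)) in R.
assert (Hrm : forall j, h (yb [+] t j [*] w) [-] t j [*] fderiv h yb w = t j [*] rm j).
{ intros j. unfold rm. rewrite Hh0. destruct Ht as [Ht _]. specialize (Ht j). vec. field. lra. }
apply (tangent_approx C yb w t (fun j => L * enorm (rm j)) Ht).
2: { replace 0 with (L * 0) by ring. apply CV_mult; [apply Un_cv_const|exact R]. }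
assert (R' := CV_mult _ _ _ _ (proj2 Ht) R). rewrite Rmult_0_l in R'.
generalize (evt_and _ _ (evt_near _ _ _ (null_seq_near yb t (fun _ => w) w Ht (cv_const w)) Hr)
  (evt_lt _ _ _ R' Hr)).
apply evt_mono. intros j [Hj Hj']. destruct Ht as [Ht _]. specialize (Ht j).
cbn beta in Hj'. rewrite Rminus_0_r, Rabs_right in Hj'
  by (apply Rle_ge, Rmult_le_pos; [lra|apply enorm_ge0]).
destruct (Hreg (yb [+] t j [*] w) (t j [*] fderiv h yb w) Hj) as (y' & E' & Hy' & Hd).
{ rewrite Hrm, enorm_scal, Rabs_right by lra. exact Hj'. }
exists y'. split.
- apply HCK; [exact Hy'|]. rewrite E'. apply HK; [lra|exact Hw].
- rewrite Hrm, enorm_scal, Rabs_right in Hd by lra. lra.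
Qed.

(** Both signs of a kernel vector of the derivative are tangent, so [lam] vanishes on the kernel and
    factors through the derivative. The multiplier is B^* lam for a right inverse [B], written out
    along the frame. *)
Lemma normal_reduction lam : rnormal C yb lam ->
  exists mu, (forall e, K e -> einner mu e <= 0) /\
    forall w, einner lam w = einner mu (fderiv h yb w).
Proof.
intros Hlam. pose proof fderiv_reduction as [Hlin _].
destruct (surjective_right_inverse _ Hlin Hsurj) as [B [HB HhB]].
assert (Hle : forall w, K (fderiv h yb w) -> einner lam w <= 0).
{ intros w Hw. apply (normal_tangent C yb); [exact Hlam|now apply tangent_reduction]. }
assert (Hker : forall w, fderiv h yb w = ezero -> einner lam w = 0).
{ intros w Hw. assert (K ezero) by apply HK.
  assert (H1 := Hle w ltac:(now rewrite Hw)).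
  assert (H2 := Hle ((-1) [*] w) ltac:(rewrite (lin_scal _ Hlin), Hw;
    replace ((-1) [*] (ezero : E)) with (ezero : E) by vec; assumption)).
  rewrite inner_scalr in H2. lra. }
destruct (finite_basis (T := E)) as [bs Hbs].
exists (fold_right (fun b acc => (einner lam (B b) [*] b) [+] acc) ezero bs).
assert (Hmu : forall e, einner (fold_right (fun b acc => (einner lam (B b) [*] b) [+] acc) ezero bs) e
  = einner lam (B e)).
{ intros e. rewrite <- (Hbs e) at 2. rewrite (lin_comb B HB). clear Hbs.
  induction bs as [|b bs IH]; cbn.
  - now rewrite inner_0l, inner_0r.
  - rewrite inner_addl, inner_addr, inner_scall, inner_scalr, IH, (inner_sym b). ring. }
split.
- intros e He. rewrite Hmu. apply Hle. now rewrite HhB.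
- intros w. rewrite Hmu.
  assert (Hz : einner lam (w [-] B (fderiv h yb w)) = 0).
  { apply Hker. rewrite (lin_sub _ Hlin), HhB. apply vsub_diag. }
  unfold vsub in Hz. rewrite inner_addr, inner_scalr in Hz. lra.
Qed.

(** For y in [C] near [yb], <mu, h y> is nonpositive and differs from <lam, y - yb> by o(|y -
    yb|). *)
Lemma reduction_normal lam mu : (forall e, K e -> einner mu e <= 0) ->
  (forall w, einner lam w = einner mu (fderiv h yb w)) -> rnormal C yb lam.
Proof.
intros Hmu Hlam. split.
- apply HCK; [now rewrite vsub_diag, enorm_0|]. rewrite Hh0. apply HK.
- intros e He. pose proof (enorm_ge0 mu).
  destruct (proj2 fderiv_reduction (e / (enorm mu + 1))) as [d [Hd H']].
  { apply Rdiv_lt_0_compat; lra. }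
  exists (Rmin d rho). split; [now apply Rmin_glb_lt|]. intros y HCy Hy.
  assert (Hyd : enorm (y [-] yb) < d) by (eapply Rlt_le_trans; [exact Hy|apply Rmin_l]).
  assert (Hyr : enorm (y [-] yb) < rho) by (eapply Rlt_le_trans; [exact Hy|apply Rmin_r]).
  specialize (H' _ Hyd). rewrite add_vsub, Hh0 in H'.
  apply HCK in HCy; [|exact Hyr]. specialize (Hmu _ HCy).
  rewrite Hlam.
  replace (einner mu (fderiv h yb (y [-] yb)))
    with (einner mu (h y) - einner mu (h y [-] ezero [-] fderiv h yb (y [-] yb)))
    by (inner_simpl; rewrite !(inner_sym mu); inner_simpl; ring).
  set (q := h y [-] ezero [-] _) in *.
  pose proof (cauchy_schwarz mu q). pose proof (Rle_abs (- einner mu q)). rewrite Rabs_Ropp in *.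
  assert (enorm mu * enorm q <= enorm mu * (e / (enorm mu + 1) * enorm (y [-] yb)))
    by now apply Rmult_le_compat_l.
  pose proof (enorm_ge0 (y [-] yb)).
  assert (enorm mu * (e / (enorm mu + 1) * enorm (y [-] yb)) <= e * enorm (y [-] yb)).
  { replace (enorm mu * (e / (enorm mu + 1) * enorm (y [-] yb)))
      with (e * enorm (y [-] yb) * (enorm mu / (enorm mu + 1))) by (field; lra).
    assert (enorm mu / (enorm mu + 1) <= 1).
    { apply (Rmult_le_reg_r (enorm mu + 1)); [lra|]. unfold Rdiv.
      rewrite Rmult_assoc, Rinv_l; lra. }
    assert (0 <= e * enorm (y [-] yb)) by nra. nra. }
  lra.
Qed.

End Reduction.

(** * Approximate multipliers *)

Lemma small_scale a b : 0 < b -> exists d0, 0 < d0 /\ forall d, 0 < d <= d0 -> d * a <= b.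
Proof.
intros Hb. pose proof (Rabs_pos a). exists (b / (Rabs a + 1)).
split; [apply Rdiv_lt_0_compat; lra|]. intros d [Hd Hd'].
assert (d * (Rabs a + 1) <= b).
{ apply (Rmult_le_compat_r (Rabs a + 1)) in Hd'; [|lra].
  unfold Rdiv in Hd'. rewrite Rmult_assoc, Rinv_l in Hd'; lra. }
pose proof (Rle_abs a). nra.
Qed.

Lemma enorm_pair {T U} `{EucLaws T} `{EucLaws U} (x : T) (y : U) :
  enorm (x, y) <= enorm x + enorm y.
Proof.
pose proof (enorm_ge0 x). pose proof (enorm_ge0 y).
apply Rsqr_incr_0; [|apply enorm_ge0|lra]. unfold Rsqr. rewrite enorm_sq. cbn.
rewrite <- !enorm_sq. nra.
Qed.

Lemma cone_combination {E} `{EucLaws E} (K : E -> Prop) t q e : closed_convex_cone K ->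
  0 <= t <= 1 -> K q -> K e -> K (q [+] t [*] (e [-] q)).
Proof.
intros HK Ht Hq He.
replace (q [+] t [*] (e [-] q)) with (t [*] e [+] (1 - t) [*] q) by vec. now apply HK.
Qed.

(** Testing with 0 and [2 [*] q], on both sides of [q] along its ray, forces orthogonality. *)
Lemma projection_polar {E} `{EucLaws E} (K : E -> Prop) d q :
  closed_convex_cone K -> K q -> (forall e, K e -> einner d (e [-] q) <= 0) ->
  einner d q = 0 /\ forall e, K e -> einner d e <= 0.
Proof.
intros HK Hq Hd.
assert (H0' := Hd ezero ltac:(apply HK)).
assert (H2 := Hd (2 [*] q) ltac:(apply HK; [lra|exact Hq])).
unfold vsub in *. rewrite !inner_addr, !inner_scalr, ?inner_0r in *.
assert (E0 : einner d q = 0) by lra. split; [exact E0|].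
intros e He. specialize (Hd e He). unfold vsub in Hd. rewrite inner_addr, inner_scalr in Hd. lra.
Qed.

(* Quadratic penalisation: minimise
   [- <v, y - x> + 2 e |y - x| + |F y - q|^2 / (2 d)] over [y] near [x] and [q] in [K];
   the multiplier is [(F y - q) / d].  The error bound keeps it bounded by
   [2 kappa (|v| + 1)] uniformly in [d], and forces [y] into the interior of the ball. *)
Lemma approximate_multiplier {X E} `{EucLaws X} `{EucLaws E} (Om : X -> Prop) (K : E -> Prop)
  (F : X -> E) F' xb r kappa x v eps :
  closed_convex_cone K -> 0 < r -> 0 <= kappa ->
  (forall y, enorm (y [-] xb) < r -> is_fderiv F y (F' y)) ->
  (forall y q, enorm (y [-] xb) < r -> K q -> enorm (F y [-] q) < r ->
     forall a, a > 0 -> exists y', Om y' /\ enorm (y [-] y') <= kappa * enorm (F y [-] q) + a) ->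
  enorm (x [-] xb) < r -> K (F x) -> rnormal Om x v -> 0 < eps <= 1 ->
  exists y q mu, enorm (y [-] x) <= eps /\ enorm (y [-] xb) < r /\ K q /\
    enorm (F y [-] q) <= eps /\ (forall e, K e -> einner mu e <= 0) /\ einner mu q = 0 /\
    enorm mu <= 2 * kappa * (enorm v + 1) /\
    forall w, Rabs (einner v w - einner mu (F' y w)) <= 2 * eps * enorm w.
Proof.
intros HK Hr Hkap HF HR Hx HKx [_ Hv] [He He1].
destruct (Hv eps He) as [del [Hdel Hnorm]].
destruct (fderiv_near F x _ 1 (HF x Hx) Rlt_0_1) as [d1 [Hd1 Hnear]].
assert (Hrho : exists rho, 0 < rho /\ rho <= eps /\ rho <= del / 4 /\ rho < d1 /\
  rho <= (r - enorm (x [-] xb)) / 2).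
{ exists (Rmin (Rmin eps (del / 4)) (Rmin (d1 / 2) ((r - enorm (x [-] xb)) / 2))).
  pose proof (Rmin_l (Rmin eps (del / 4)) (Rmin (d1 / 2) ((r - enorm (x [-] xb)) / 2))).
  pose proof (Rmin_r (Rmin eps (del / 4)) (Rmin (d1 / 2) ((r - enorm (x [-] xb)) / 2))).
  pose proof (Rmin_l eps (del / 4)). pose proof (Rmin_r eps (del / 4)).
  pose proof (Rmin_l (d1 / 2) ((r - enorm (x [-] xb)) / 2)).
  pose proof (Rmin_r (d1 / 2) ((r - enorm (x [-] xb)) / 2)).
  repeat split; try lra. repeat apply Rmin_glb_lt; lra. }
destruct Hrho as (rho & Hrho & Hrho1 & Hrho2 & Hrho3 & Hrho4).
set (N := enorm v + 1). pose proof (enorm_ge0 v) as Hv0.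
assert (HN : 1 <= N) by (unfold N; lra).
(* Target for the residual: 1/2 keeps [q] inside its truncation, r/2 keeps the error bound
   applicable, and the last term puts the feasible point it yields within [del] of [x]. *)
set (m := Rmin (1 / 2) (Rmin (r / 2) (del / (4 * (kappa + 1))))).
assert (Hm : 0 < m).
{ repeat apply Rmin_glb_lt; try lra. apply Rdiv_lt_0_compat; lra. }
assert (Hm1 : m <= 1 / 2) by apply Rmin_l.
assert (Hm2 : m <= r / 2) by (eapply Rle_trans; [apply Rmin_r|apply Rmin_l]).
assert (Hm3 : kappa * m <= del / 4).
{ assert (M : m <= del / (4 * (kappa + 1))) by (eapply Rle_trans; [apply Rmin_r|apply Rmin_r]).
  apply Rle_trans with ((kappa + 1) * (del / (4 * (kappa + 1)))).
  - apply Rmult_le_compat; lra.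
  - right. field. lra. }
(* The three conditions on the penalty parameter give, in this order, residual at most [m], [y] in
   the interior of the ball, and residual at most [eps]. *)
assert (Hdelta : exists d, 0 < d /\ d * (2 * N) <= m * m /\
  d * (2 * (kappa * kappa) * (N * N)) <= eps * rho / 2 /\ d * (2 * kappa * N) <= eps).
{ destruct (small_scale (2 * N) (m * m)) as [a1 [Ha1 A1]]; [nra|].
  destruct (small_scale (2 * (kappa * kappa) * (N * N)) (eps * rho / 2)) as [a2 [Ha2 A2]]; [nra|].
  destruct (small_scale (2 * kappa * N) eps He) as [a3 [Ha3 A3]].
  exists (Rmin a1 (Rmin a2 a3)).
  pose proof (Rmin_l a1 (Rmin a2 a3)). pose proof (Rmin_r a1 (Rmin a2 a3)).
  pose proof (Rmin_l a2 a3). pose proof (Rmin_r a2 a3).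
  assert (0 < Rmin a1 (Rmin a2 a3)) by (repeat apply Rmin_glb_lt; lra).
  split; [assumption|]. split; [apply A1|split; [apply A2|apply A3]]; lra. }
destruct Hdelta as (d & Hd & Hda & Hdb & Hdc).
assert (Hid : 0 < / (2 * d)) by (apply Rinv_0_lt_compat; lra).
assert (Hball : forall y, enorm (y [-] x) <= rho -> enorm (y [-] xb) < r).
{ intros y Hy. pose proof (enorm_tri y x xb). lra. }
(* Truncating [K] only provides compactness: at the minimiser the norm of [q] is at most that of
   [F x] plus 1 plus 1/2. *)
set (S := fun z : X * E => enorm (fst z [-] x) <= rho /\ K (snd z) /\
  enorm (snd z [-] ezero) <= enorm (F x) + 3).
(* Half of the slope [2 * eps] absorbs the defect in the definition of a regular normal, see [I2];
   the other half survives in [I3] and bounds the distance from [y] to [x]. *)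
set (Phi := fun z : X * E => - einner v (fst z [-] x) + 2 * eps * enorm (fst z [-] x)
  + / (2 * d) * einner (F (fst z) [-] snd z) (F (fst z) [-] snd z)).
assert (HSx : S (x, F x)).
{ unfold S; cbn. rewrite vsub_diag, enorm_0, vsub_0r. repeat split; [lra|exact HKx|lra]. }
destruct (minimum_attained S Phi (x, F x) (enorm x + rho + (enorm (F x) + 3)) (- (enorm v * rho)))
  as [[y q] [[Hy [Hq Hqb]] Hmin]]; [exact HSx| | | | |].
{ intros [y q] [Hy [_ Hqb]]. cbn in Hy, Hqb. rewrite vsub_0r in Hqb.
  pose proof (enorm_pair y q). pose proof (enorm_le_add y x). lra. }
{ intros z l Hz Hl. split; [|split].
  - apply (closed_ball_cv x rho (fun j => fst (z j))); [apply Hz|now apply cv_fst].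
  - apply (eclosed_cv K (fun j => snd (z j))); [apply HK|apply evt_all; apply Hz|now apply cv_snd].
  - apply (closed_ball_cv ezero _ (fun j => snd (z j))); [apply Hz|now apply cv_snd]. }
{ intros [y q] [Hy _]. unfold Phi. cbn in *.
  pose proof (inner_le v (y [-] x)). pose proof (inner_ge0 (F y [-] q)).
  pose proof (enorm_ge0 (y [-] x)).
  assert (enorm v * enorm (y [-] x) <= enorm v * rho) by now apply Rmult_le_compat_l.
  assert (0 <= / (2 * d) * einner (F y [-] q) (F y [-] q)) by (apply Rmult_le_pos; lra).
  nra. }
{ intros z l Hz Hl Hzl.
  pose proof (cv_fst _ _ Hzl) as C1. pose proof (cv_snd _ _ Hzl) as C2.
  assert (C3 : cv (fun j => fst (z j) [-] x) (fst l [-] x)) by (apply cv_sub; [exact C1|apply cv_const]).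
  assert (C4 : cv (fun j => F (fst (z j)) [-] snd (z j)) (F (fst l) [-] snd l)).
  { apply cv_sub; [|exact C2].
    apply (fderiv_continuous _ _ _ _ (HF (fst l) (Hball _ (proj1 Hl))) C1). }
  unfold Phi. apply CV_plus; [apply CV_plus|].
  - apply (CV_opp (fun j => einner v (fst (z j) [-] x))). apply cv_inner; [apply cv_const|exact C3].
  - apply CV_mult; [apply Un_cv_const|now apply cv_enorm].
  - apply CV_mult; [apply Un_cv_const|now apply cv_inner]. }
cbn in Hy, Hq, Hqb. rewrite vsub_0r in Hqb.
set (e := F y [-] q) in *. set (D := enorm e).
assert (HD0 : 0 <= D) by apply enorm_ge0.
assert (HDe : einner e e = D * D) by (symmetry; apply enorm_sq).
pose proof (enorm_ge0 (y [-] x)) as Hyx0.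
assert (I1 : / (2 * d) * (D * D) + 2 * eps * enorm (y [-] x) <= einner v (y [-] x)).
{ assert (M := Hmin _ HSx). unfold Phi in M. cbn [fst snd] in M. fold e in M.
  rewrite !vsub_diag, enorm_0, inner_0r, inner_0l, HDe in M. lra. }
assert (I1' : D * D <= 2 * d * (enorm v * rho)).
{ apply (Rmult_le_reg_l (/ (2 * d))); [exact Hid|].
  replace (/ (2 * d) * (2 * d * (enorm v * rho))) with (enorm v * rho) by (field; lra).
  pose proof (inner_le v (y [-] x)).
  assert (enorm v * enorm (y [-] x) <= enorm v * rho) by now apply Rmult_le_compat_l.
  assert (0 <= eps * enorm (y [-] x)) by (apply Rmult_le_pos; lra). lra. }
assert (HDm : D <= m).
{ apply Rsqr_incr_0; unfold Rsqr; try lra.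
  assert (enorm v * rho <= N * 1) by (apply Rmult_le_compat; unfold N; lra).
  assert (d * (2 * (enorm v * rho)) <= d * (2 * N)) by (apply Rmult_le_compat_l; lra). lra. }
(* The error bound replaces [y] by a feasible [y'], where normality applies. The [+ 1] in [N] pays
   for the extra distance from [y'] to [x], as [eps <= 1]. *)
assert (I2 : einner v (y [-] x) <= eps * enorm (y [-] x) + N * (kappa * D)).
{ apply le_epsilon. intros eta Heta.
  set (a := Rmin (del / 8) (eta / N)).
  assert (Ha : 0 < a) by (apply Rmin_glb_lt; [lra|apply Rdiv_lt_0_compat; lra]).
  assert (Ha1 : a <= del / 8) by apply Rmin_l.
  assert (Ha2 : N * a <= eta).
  { apply Rle_trans with (N * (eta / N)); [apply Rmult_le_compat_l; [lra|apply Rmin_r]|].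
    right. field. lra. }
  destruct (HR y q (Hball y Hy) Hq) with (a := a) as [y' [HOm Hy']]; [fold e D; lra|lra|].
  fold e D in Hy'.
  assert (kappa * D <= kappa * m) by (apply Rmult_le_compat_l; lra).
  pose proof (enorm_tri y' y x) as T1. rewrite (enorm_opp y' y) in T1.
  assert (Hd' : enorm (y' [-] x) < del) by lra.
  specialize (Hnorm y' HOm Hd').
  replace (einner v (y [-] x)) with (einner v (y' [-] x) + einner v (y [-] y'))
    by (unfold vsub; rewrite !inner_addr, !inner_scalr; ring).
  pose proof (inner_le v (y [-] y')).
  assert (enorm v * enorm (y [-] y') <= enorm v * (kappa * D + a)) by now apply Rmult_le_compat_l.
  assert (eps * enorm (y' [-] x) <= eps * (kappa * D + a + enorm (y [-] x)))
    by (apply Rmult_le_compat_l; lra).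
  assert (eps * (kappa * D + a) <= 1 * (kappa * D + a)).
  { apply Rmult_le_compat_r; [|lra]. assert (0 <= kappa * D) by now apply Rmult_le_pos. lra. }
  unfold N in Ha2 |- *. lra. }
assert (I3 : / (2 * d) * (D * D) + eps * enorm (y [-] x) <= N * (kappa * D)) by lra.
assert (HDk : D <= d * (2 * kappa * N)).
{ destruct (Req_dec D 0) as [E0|E0].
  - rewrite E0. apply Rmult_le_pos; [lra|]. apply Rmult_le_pos; lra.
  - assert (0 <= eps * enorm (y [-] x)) by (apply Rmult_le_pos; lra).
    apply (Rmult_le_reg_l (/ (2 * d) * D)); [apply Rmult_lt_0_compat; lra|].
    replace (/ (2 * d) * D * (d * (2 * kappa * N))) with (N * (kappa * D)) by (field; lra). lra. }
assert (Hyint : enorm (y [-] x) < rho).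
{ assert (0 <= / (2 * d) * (D * D)) by (apply Rmult_le_pos; [lra|nra]).
  assert (N * (kappa * D) <= N * (kappa * (d * (2 * kappa * N)))).
  { apply Rmult_le_compat_l; [lra|]. now apply Rmult_le_compat_l. }
  apply (Rmult_lt_reg_l eps); [lra|]. assert (0 < eps * rho) by nra. lra. }
assert (Hqint : enorm q < enorm (F x) + 3).
{ pose proof (enorm_le_add q (F y)) as T1. rewrite (enorm_opp q) in T1. fold e D in T1.
  pose proof (enorm_le_add (F y) (F x)). specialize (Hnear y ltac:(lra)). lra. }
pose proof null_seq_inv_S as Ht. set (t := fun j => / INR (Datatypes.S j)) in Ht.
assert (Hpolar : forall k, K k -> einner e (k [-] q) <= 0).
{ intros k Hk.
  apply (Un_cv_le (fun _ => einner e (k [-] q)) (fun j => t j * (einner (k [-] q) (k [-] q) / 2)) _ 0).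
  2: apply Un_cv_const.
  2: { replace 0 with (0 * (einner (k [-] q) (k [-] q) / 2)) by ring.
       apply CV_mult; [apply Ht|apply Un_cv_const]. }
  pose proof (null_seq_near q t _ _ Ht (cv_const (k [-] q))) as Cq.
  assert (Hgap : 0 < enorm (F x) + 3 - enorm q) by lra.
  generalize (evt_and _ _ (null_seq_le1 t Ht) (evt_near _ _ _ Cq Hgap)).
  apply evt_mono. intros j [Hj Hjq]. cbn beta in Hjq. set (s := t j) in *.
  pose proof (enorm_le_add (q [+] s [*] (k [-] q)) q).
  assert (HS : S (y, q [+] s [*] (k [-] q))).
  { unfold S. cbn [fst snd]. rewrite vsub_0r. split; [exact Hy|]. split; [|lra].
    apply cone_combination; auto. lra. }
  assert (M := Hmin _ HS). unfold Phi in M. cbn [fst snd] in M. fold e in M.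
  replace (F y [-] (q [+] s [*] (k [-] q))) with (e [-] s [*] (k [-] q)) in M
    by (unfold e; vec).
  assert (M' : einner e e <= einner (e [-] s [*] (k [-] q)) (e [-] s [*] (k [-] q))).
  { apply (Rmult_le_reg_l (/ (2 * d))); [exact Hid|]. lra. }
  set (b := k [-] q) in *. unfold vsub in M'.
  rewrite !inner_addl, !inner_scall, !inner_addr, !inner_scalr, (inner_sym b e) in M'.
  apply (Rmult_le_reg_l s); [lra|]. lra. }
destruct (projection_polar K e q HK Hq Hpolar) as [Heq Hek].
(* The nonsmooth term contributes at most its slope [2 * eps], the quadratic one vanishes with the
   step. Applying this to both [w] and its opposite gives the absolute value. *)
assert (Hstat : forall w, einner v w - einner (/ d [*] e) (F' y w) <= 2 * eps * enorm w).
{ intros w. rewrite inner_scall.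
  pose proof (fderiv_hadamard _ _ _ _ _ _ (HF y (Hball y Hy)) Ht (cv_const w)) as C.
  set (Q := fun j => / t j [*] (F (y [+] t j [*] w) [-] F y)) in C.
  pose proof (cv_inner _ _ _ _ (cv_const e) C) as C1.
  pose proof (cv_inner _ _ _ _ C C) as C2.
  assert (einner v w <= 2 * eps * enorm w + (/ d * einner e (F' y w)
    + 0 * (/ (2 * d) * einner (F' y w) (F' y w)))); [|lra].
  apply (Un_cv_le (fun _ => einner v w) (fun j => 2 * eps * enorm w + (/ d * einner e (Q j)
    + t j * (/ (2 * d) * einner (Q j) (Q j))))).
  2: apply Un_cv_const.
  2: { apply CV_plus; [apply Un_cv_const|]. apply CV_plus.
       - apply CV_mult; [apply Un_cv_const|exact C1].
       - apply CV_mult; [apply Ht|]. apply CV_mult; [apply Un_cv_const|exact C2]. }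
  assert (Hgap : 0 < rho - enorm (y [-] x)) by lra.
  generalize (evt_and _ _ (null_seq_le1 t Ht)
    (evt_near _ _ _ (null_seq_near y t _ _ Ht (cv_const w)) Hgap)).
  apply evt_mono. intros j [Hj Hjy]. cbn beta in Hjy.
  assert (HFQ : F (y [+] t j [*] w) [-] q = e [+] t j [*] Q j).
  { unfold Q, e. vec. field. lra. }
  set (s := t j) in *.
  pose proof (enorm_tri (y [+] s [*] w) y x) as T1.
  assert (HS : S (y [+] s [*] w, q)).
  { unfold S. cbn [fst snd]. rewrite vsub_0r. split; [lra|]. split; [exact Hq|lra]. }
  assert (M := Hmin _ HS). unfold Phi in M. cbn [fst snd] in M. fold e in M.
  rewrite HFQ in M.
  replace (y [+] s [*] w [-] x) with ((y [-] x) [+] s [*] w) in M by vec.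
  assert (T2 := enorm_add (y [-] x) (s [*] w)).
  rewrite enorm_scal, Rabs_right in T2 by lra.
  rewrite inner_addr, inner_scalr in M.
  assert (T3 : 2 * eps * enorm ((y [-] x) [+] s [*] w) <=
    2 * eps * (enorm (y [-] x) + s * enorm w)) by (apply Rmult_le_compat_l; lra).
  rewrite !inner_addl, !inner_scall, !inner_addr, !inner_scalr, (inner_sym (Q j) e) in M.
  apply (Rmult_le_reg_l s); [lra|].
  replace (/ d * einner e (Q j)) with (2 * (/ (2 * d) * einner e (Q j))) by (field; lra).
  lra. }
exists y, q, (/ d [*] e). split; [lra|]. split; [now apply Hball|]. split; [exact Hq|].
split; [fold e D; lra|]. split.
{ intros k Hk. rewrite inner_scall. specialize (Hek k Hk).
  assert (0 < / d) by now apply Rinv_0_lt_compat. nra. }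
split; [rewrite inner_scall, Heq; ring|]. split.
{ rewrite enorm_scal, Rabs_right by (left; now apply Rinv_0_lt_compat). fold D N.
  apply (Rmult_le_reg_l d); [lra|]. rewrite <- Rmult_assoc, Rinv_r; lra. }
intros w. apply Rabs_le. split; [|apply Hstat].
specialize (Hstat ((-1) [*] w)).
rewrite (lin_scal _ (proj1 (HF y (Hball y Hy)))), !inner_scalr, enorm_scal, Rabs_left in Hstat by lra.
lra.
Qed.

(** * Passage to the limit *)

(* The coordinates in [bs] are eliminated one at a time, as in Gaussian elimination. *)
Lemma bounded_selection {T U} `{EucLaws T} `{EucLaws U} (R : T -> U -> Prop) :
  R ezero ezero ->
  (forall x y x' y' t, R x y -> R x' y' -> R (x [+] t [*] x') (y [+] t [*] y')) ->
  exists c, 0 <= c /\ forall x y, R x y -> exists y', R x y' /\ enorm y' <= c * enorm x.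
Proof.
(* In place of the frame property, the list is only required to separate the domain of the relation.
   This is inherited by subrelations when a coordinate is removed. *)
assert (B : forall bs (R : T -> U -> Prop), R ezero ezero ->
  (forall x y x' y' t, R x y -> R x' y' -> R (x [+] t [*] x') (y [+] t [*] y')) ->
  (forall x y, R x y -> (forall b, In b bs -> einner x b = 0) -> x = ezero) ->
  exists c, 0 <= c /\ forall x y, R x y -> exists y', R x y' /\ enorm y' <= c * enorm x).
{ intros bs. induction bs as [|b bs IH]; intros Q Q0 Ql Qz.
  - exists 0. split; [lra|]. intros x y Hxy. exists ezero.
    rewrite (Qz x y Hxy) by (intros ? []). split; [exact Q0|]. rewrite !enorm_0. lra.
  - destruct (classic (exists x y, Q x y /\ einner x b = 1)) as [(xh & yh & Hh & Hb)|N].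
    + destruct (IH (fun x y => Q x y /\ einner x b = 0)) as [c [Hc Hsel]].
      * split; [exact Q0|apply inner_0l].
      * intros x y x' y' t [H1 H2] [H3 H4]. split; [now apply Ql|].
        rewrite inner_addl, inner_scall, H2, H4. ring.
      * intros x y [H1 H2] H3. apply (Qz x y H1). intros b' [<-|Hb']; auto.
      * pose proof (enorm_ge0 xh). pose proof (enorm_ge0 yh). pose proof (enorm_ge0 b).
        exists (c * (1 + enorm b * enorm xh) + enorm b * enorm yh). split.
        { assert (0 <= enorm b * enorm xh) by nra. assert (0 <= enorm b * enorm yh) by nra. nra. }
        intros x y Hxy. set (s := einner x b).
        destruct (Hsel (x [+] (- s) [*] xh) (y [+] (- s) [*] yh)) as (y' & [Hy1 _] & Hy2).
        { split; [now apply Ql|]. rewrite inner_addl, inner_scall, Hb. unfold s. ring. }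
        exists (y' [+] s [*] yh). split.
        { replace x with (x [+] (- s) [*] xh [+] s [*] xh) by vec. now apply Ql. }
        assert (Hs : Rabs s <= enorm b * enorm x) by (rewrite Rmult_comm; apply cauchy_schwarz).
        eapply Rle_trans; [apply enorm_add|]. rewrite enorm_scal.
        assert (E : enorm (x [+] (- s) [*] xh) <= enorm x + enorm b * enorm x * enorm xh).
        { eapply Rle_trans; [apply enorm_add|]. rewrite enorm_scal, Rabs_Ropp.
          apply Rplus_le_compat_l, Rmult_le_compat_r; lra. }
        assert (Rabs s * enorm yh <= enorm b * enorm x * enorm yh)
          by (apply Rmult_le_compat_r; lra).
        assert (c * enorm (x [+] (- s) [*] xh) <= c * (enorm x + enorm b * enorm x * enorm xh))
          by now apply Rmult_le_compat_l.
        lra.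
    + apply (IH Q Q0 Ql). intros x y Hxy Hx. apply (Qz x y Hxy).
      intros b' [<-|Hb']; [|now apply Hx].
      apply NNPP. intros Nz. apply N.
      exists (ezero [+] / einner x b [*] x), (ezero [+] / einner x b [*] y).
      split; [now apply Ql|]. rewrite inner_addl, inner_0l, inner_scall. now field. }
intros R0 Rl. destruct (finite_basis (T := T)) as [bs Hbs].
apply (B bs R R0 Rl). intros x y _ Hx. rewrite <- (Hbs x). clear Hbs B.
induction bs as [|b bs IH]; [reflexivity|]. cbn. fold (comb bs x).
rewrite IH by (intros; apply Hx; now right). rewrite (Hx b) by now left. vec.
Qed.

Section Limit.
Context {P X E : Type} {HP : Euc P} {LP : EucLaws P} {HX : Euc X} {LX : EucLaws X}
  {HE : Euc E} {LE : EucLaws E}.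
Variables (G : P * X -> E) (G' D : P * X -> P * X -> E) (f f' : P * X -> X) (z : P * X) (del : R)
  (K : E -> Prop).
Hypotheses (HG : twice_fderiv G G' D z del) (HG0 : G z = ezero) (Hf : is_fderiv f z f')
  (HK : closed_convex_cone K).
(** Everything is rescaled by [t]: [a] is the parameter direction, [u] points to the solution and
    [u'] to the auxiliary point carrying the multiplier. The parameter increment splits into [b],
    which lies in P, and [r] of order o(t^2). *)
Variables (t : nat -> R) (a b r : nat -> P) (u u' : nat -> X) (u0 : X) (mu q : nat -> E) (mu0 : E).
Hypotheses (Ht : null_seq t) (Ha : cv a ezero) (Hu : cv u u0) (Hu' : cv u' u0) (Hmu : cv mu mu0)
  (Hpol : forall j e, K e -> einner (mu j) e <= 0)
  (HKq : forall j, K (q j)) (Hmuq : forall j, einner (mu j) (q j) = 0).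
Hypothesis Hq : cv (fun j => / (t j * t j) [*] (q j [-] G (z [+] t j [*] (a j, u' j)))) ezero.
Hypothesis Hstat : forall w, Un_cv (fun j => (einner (f (z [+] t j [*] (a j, u j))) w +
  einner (mu j) (G' (z [+] t j [*] (a j, u' j)) (ezero, w))) / t j) 0.
Hypotheses (Hsplit : forall j, t j [*] a j = b j [+] r j)
  (Hb : forall j, exists v w, linK K w /\ G' z (b j, ezero) = G' z (ezero, v) [+] w)
  (Hr : cv (fun j => / (t j * t j) [*] r j) ezero).

Let A := G' z.
(** [Phi w] will be identified with <F_lam u0, w> for the pulled-back multiplier by [Fop_eq]; [L j]
    is the functional A_x^*(mu_j - mu0)/t_j. *)
Let Phi w := einner (f' (ezero, u0)) w + einner mu0 (D (ezero, u0) (ezero, w)).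
Let L j w := einner (mu j [-] mu0) (A (ezero, w)) / t j.

Lemma limit_linear : linear_map A.
Proof. apply HG. rewrite vsub_diag, enorm_0. apply HG. Qed.

Lemma limit_dir : cv (fun j => (a j, u j)) (ezero, u0).
Proof. now apply cv_pair. Qed.

Lemma limit_dir' : cv (fun j => (a j, u' j)) (ezero, u0).
Proof. now apply cv_pair. Qed.

Lemma limit_polar e : K e -> einner mu0 e <= 0.
Proof.
intros He. apply (Un_cv_le (fun j => einner (mu j) e) (fun _ => 0)).
- apply evt_all. intros j. now apply Hpol.
- now apply cv_inner_const.
- apply Un_cv_const.
Qed.

Lemma limit_stationary w : einner (f z) w + einner mu0 (A (ezero, w)) = 0.
Proof.
pose proof (fderiv_continuous _ _ _ _ Hf (null_seq_near z _ _ _ Ht limit_dir)) as C1.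
pose proof (fderiv_continuous _ _ _ _ (proj2 (proj2 HG) (ezero, w))
  (null_seq_near z _ _ _ Ht limit_dir')) as C2.
eapply UL_sequence.
- apply CV_plus; [exact (cv_inner_const _ _ w C1)|exact (cv_inner _ _ _ _ Hmu C2)].
- replace 0 with (0 * 0) by ring.
  eapply Un_cv_evt_eq; [|exact (CV_mult _ _ _ _ (proj2 Ht) (Hstat w))].
  apply evt_all. intros j. destruct Ht as [Hp _]. specialize (Hp j). cbn beta. field. lra.
Qed.

Lemma limit_quotient w : Un_cv (fun j => L j w) (- Phi w).
Proof.
pose proof (fderiv_hadamard _ _ _ _ _ _ Hf Ht limit_dir) as C1.
pose proof (fderiv_quotient _ _ _ _ _ HG _ _ _ _ _ Ht limit_dir' (cv_const (ezero, w))) as C2.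
apply (cv_inner_const _ _ w) in C1. pose proof (cv_inner _ _ _ _ Hmu C2) as C3.
replace (- Phi w) with (0 - einner (f' (ezero, u0)) w - einner mu0 (D (ezero, u0) (ezero, w)))
  by (unfold Phi; ring).
eapply Un_cv_evt_eq; [|exact (CV_minus _ _ _ _ (CV_minus _ _ _ _ (Hstat w) C1) C3)].
apply evt_all. intros j. destruct Ht as [Hp _]. specialize (Hp j). cbn beta.
pose proof (limit_stationary w) as S. unfold L. fold A.
unfold vsub. rewrite !inner_scalr, !inner_scall, !inner_addr, !inner_addl, !inner_scalr, !inner_scall.
replace (einner mu0 (A (ezero, w))) with (- einner (f z) w) by lra. field. lra.
Qed.

Lemma limit_L_linear j : linear_map (L j).
Proof.
destruct limit_linear as [Aa As]. split; intros.
- unfold L. replace ((ezero : P, x [+] y)) with ((ezero : P, x) [+] (ezero, y)) by (cbn; f_equal; vec).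
  rewrite Aa, inner_addr. cbn. unfold Rdiv. ring.
- unfold L. replace ((ezero : P, t0 [*] x)) with (t0 [*] (ezero : P, x)) by (cbn; f_equal; vec).
  rewrite As, inner_scalr. cbn. unfold Rdiv. ring.
Qed.

Lemma limit_L_cv x l : cv x l -> Un_cv (fun j => L j (x j)) (- Phi l).
Proof.
intros Hx.
assert (C : cv (fun j => L j (x j)) (- Phi l)).
{ apply (lin_cv L (fun w => - Phi w)); [apply evt_all, limit_L_linear| |exact Hx].
  intros w. apply cv_weak. intros y. cbn. apply CV_mult; [apply limit_quotient|apply Un_cv_const]. }
(* [R] was treated as a Euclidean space; testing against 1 returns to [Un_cv]. *)
apply (cv_inner_const _ _ 1) in C. cbn in C. rewrite Rmult_1_r in C. revert C.
apply Un_cv_evt_eq, evt_all. intros j. ring.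
Qed.

Lemma limit_critical_quotient : cv (fun j => / t j [*] q j) (A (ezero, u0)).
Proof.
assert (Hz : is_fderiv G z (G' z)) by (apply HG; rewrite vsub_diag, enorm_0; apply HG).
pose proof (fderiv_hadamard _ _ _ _ _ _ Hz Ht limit_dir') as C1.
apply (cv_eq (fun j => t j [*] (/ (t j * t j) [*] (q j [-] G (z [+] t j [*] (a j, u' j))))
  [+] / t j [*] (G (z [+] t j [*] (a j, u' j)) [-] G z)) _ (0 [*] ezero [+] A (ezero, u0))).
- intros j. rewrite HG0. destruct Ht as [Hp _]. specialize (Hp j). vec. field. lra.
- vec.
- apply cv_add; [|exact C1]. apply cv_scal; [apply Ht|exact Hq].
Qed.

Lemma limit_critical : K (A (ezero, u0)) /\ einner mu0 (A (ezero, u0)) = 0.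
Proof.
pose proof limit_critical_quotient as C. split.
- apply (eclosed_cv K (fun j => / t j [*] q j)); [apply HK| |exact C].
  apply evt_all. intros j. apply HK; [|apply HKq].
  destruct Ht as [Hp _]. specialize (Hp j). left. now apply Rinv_0_lt_compat.
- eapply UL_sequence; [exact (cv_inner _ _ _ _ Hmu C)|].
  apply (Un_cv_evt_eq (fun _ => 0)); [|apply Un_cv_const].
  apply evt_all. intros j. rewrite inner_scalr, Hmuq. ring.
Qed.

Lemma limit_Phi_ge0 w : K (A (ezero, w)) -> einner mu0 (A (ezero, w)) = 0 -> 0 <= Phi w.
Proof.
intros Hw E0. assert (- Phi w <= 0); [|lra].
apply (Un_cv_le (fun j => L j w) (fun _ => 0)); [|apply limit_quotient|apply Un_cv_const].
apply evt_all. intros j. unfold L, vsub. rewrite inner_addl, inner_scall, E0.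
specialize (Hpol j _ Hw). destruct Ht as [Hp _]. specialize (Hp j).
assert (0 < / t j) by now apply Rinv_0_lt_compat. unfold Rdiv. nra.
Qed.

(** The term equals L_j(v_j/t_j) plus <mu_j - mu0, A(r_j/t_j^2, 0)>. The second part tends to 0
    since both factors do. For the first, an arbitrary [v j] could be too large; [bounded_selection]
    provides one bounded by a multiple of [b j], so that v_j/t_j -> 0. *)
Lemma limit_parameter :
  Un_cv (fun j => einner (mu j [-] mu0) (A (a j, ezero)) / t j) 0.
Proof.
destruct limit_linear as [Aa As].
assert (A0 : A (ezero, ezero) = ezero) by exact (lin_0 A limit_linear).
set (Rl := fun (p : P) (x : X) => exists w, linK K w /\ A (p, ezero) = A (ezero, x) [+] w).
destruct HK as (_ & HK0 & HKs & HKc).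
assert (HKadd : forall x y, K x -> K y -> K (x [+] y)).
{ intros x y Hx Hy. replace (x [+] y) with (2 [*] (/ 2 [*] x [+] (1 - / 2) [*] y)) by (vec; field).
  apply HKs; [lra|]. apply HKc; auto; lra. }
assert (Hlin : forall x s, linK K x -> K (s [*] x)).
{ intros x s [H1 H2]. destruct (Rle_dec 0 s).
  - apply HKs; [lra|exact H1].
  - replace (s [*] x) with ((- s) [*] (-1 [*] x)) by vec. apply HKs; [lra|exact H2]. }
destruct (bounded_selection Rl) as [c [Hc Hsel]].
- exists ezero. split.
  + split; [exact HK0|]. replace (-1 [*] (ezero : E)) with (ezero : E) by vec. exact HK0.
  + vec.
- intros x y x' y' s [w [Hw E1]] [w' [Hw' E2]]. exists (w [+] s [*] w'). split.
  + split.
    * apply HKadd; [apply Hw|now apply Hlin].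
    * replace (-1 [*] (w [+] s [*] w')) with (-1 [*] w [+] (- s) [*] w') by vec.
      apply HKadd; [apply Hw|now apply Hlin].
  + replace (x [+] s [*] x', ezero : X) with ((x, ezero : X) [+] s [*] (x', ezero))
      by (cbn; f_equal; vec).
    replace (ezero : P, y [+] s [*] y') with ((ezero : P, y) [+] s [*] (ezero, y'))
      by (cbn; f_equal; vec).
    rewrite !Aa, !As, E1, E2. vec.
- assert (Hv : forall j, exists v, Rl (b j) v /\ enorm v <= c * enorm (b j)).
  { intros j. destruct (Hb j) as (v & w & Hw). apply (Hsel (b j) v). now exists w. }
  apply choice in Hv as [v Hv].
  assert (Cb : cv (fun j => / t j [*] b j) ezero).
  { apply (cv_eq (fun j => a j [-] t j [*] (/ (t j * t j) [*] r j)) _ (ezero [-] 0 [*] ezero)).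
    - intros j. destruct Ht as [Hp _]. specialize (Hp j).
      assert (Eb : b j = t j [*] a j [-] r j) by (rewrite Hsplit; vec).
      rewrite Eb. vec. field. lra.
    - vec.
    - apply cv_sub; [exact Ha|]. apply cv_scal; [apply Ht|exact Hr]. }
  assert (Cv : cv (fun j => / t j [*] v j) ezero).
  { apply (cv_squeeze _ (fun j => c * enorm (/ t j [*] b j))).
    - apply evt_all. intros j. destruct Ht as [Hp _]. specialize (Hp j).
      assert (0 < / t j) by now apply Rinv_0_lt_compat.
      rewrite !enorm_scal, Rabs_right by lra. destruct (Hv j) as [_ Hvj].
      apply (Rmult_le_compat_l (/ t j)) in Hvj; lra.
    - replace 0 with (c * 0) by ring. apply CV_mult; [apply Un_cv_const|].
      apply cv_enorm in Cb. now rewrite enorm_0 in Cb. }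
  pose proof (limit_L_cv _ _ Cv) as C1.
  (* [twice_fderiv] records linearity of [D] in the first argument; [schwarz] moves the zero
     there. *)
  assert (Phi0 : Phi ezero = 0).
  { unfold Phi. rewrite inner_0r, (schwarz G G' D z del HG).
    change (ezero : P, ezero : X) with (ezero : P * X).
    rewrite (lin_0 _ (proj1 (proj2 (proj2 HG) (ezero, u0)))), inner_0r. ring. }
  rewrite Phi0, Ropp_0 in C1.
  assert (C2 : cv (fun j => A (/ (t j * t j) [*] r j, ezero)) (A (ezero, ezero))).
  { apply (lin_cv_const A (fun j => (/ (t j * t j) [*] r j, ezero))); [exact limit_linear|].
    apply cv_pair; [exact Hr|apply cv_const]. }
  rewrite A0 in C2.
  pose proof (cv_inner _ _ _ _ (cv_sub _ _ _ _ Hmu (cv_const mu0)) C2) as C3.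
  rewrite inner_0r in C3. replace 0 with (0 + 0) by ring.
  eapply Un_cv_evt_eq; [|exact (CV_plus _ _ _ _ C1 C3)].
  apply evt_all. intros j. cbn beta. destruct Ht as [Hp _]. specialize (Hp j).
  destruct (Hv j) as [[w [[Hw1 Hw2] Ew]] _].
  assert (Hw0 : einner (mu j [-] mu0) w = 0).
  { pose proof (Hpol j _ Hw1). pose proof (Hpol j _ Hw2).
    pose proof (limit_polar _ Hw1). pose proof (limit_polar _ Hw2).
    rewrite !inner_scalr in *. inner_simpl. lra. }
  assert (Ea : einner (mu j [-] mu0) (A (a j, ezero)) =
    / t j * (einner (mu j [-] mu0) (A (ezero, v j)) + einner (mu j [-] mu0) (A (r j, ezero)))).
  { replace (a j, ezero : X) with (/ t j [*] ((b j, ezero : X) [+] (r j, ezero))).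
    - rewrite As, Aa, inner_scalr, inner_addr, Ew, inner_addr, Hw0. ring.
    - cbn. f_equal; [|vec]. rewrite <- Hsplit. vec. field. lra. }
  rewrite Ea. rewrite (lin_scal _ (limit_L_linear j)). unfold L. cbn [escal Euc_R].
  replace (/ (t j * t j) [*] r j, ezero : X) with (/ (t j * t j) [*] (r j, ezero : X))
    by (cbn; f_equal; vec).
  rewrite As, inner_scalr. field. lra.
Qed.

(** Divide <mu_j - nu, q_j> by t_j^2. In the first-order term [nu] may be replaced by [mu0], since
    they agree on the range of [A]; what is left is the parameter term plus L_j(u'_j), whose limit
    is -Phi(u0). *)
Lemma limit_maximal nu : (forall e, K e -> einner nu e <= 0) ->
  (forall v, einner nu (A v) = einner mu0 (A v)) ->
  Phi u0 <= / 2 * (einner mu0 (D (ezero, u0) (ezero, u0)) - einner nu (D (ezero, u0) (ezero, u0))).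
Proof.
intros Hnu Enu.
pose proof (taylor_second_order _ _ _ _ _ HG _ _ _ Ht limit_dir') as C1.
pose proof (cv_inner _ _ _ _ (cv_sub _ _ _ _ Hmu (cv_const nu)) (cv_add _ _ _ _ Hq C1)) as C2.
pose proof (CV_plus _ _ _ _ (CV_plus _ _ _ _ C2 limit_parameter) (limit_L_cv _ _ Hu')) as C.
assert (M : 0 <= einner (mu0 [-] nu) (ezero [+] / 2 [*] D (ezero, u0) (ezero, u0)) + 0 + - Phi u0).
{ eapply (Un_cv_le (fun _ => 0)); [|apply Un_cv_const|exact C].
  apply evt_all. intros j. cbn beta. destruct Ht as [Hp _]. specialize (Hp j).
  set (s := t j) in *. set (y := (a j, u' j)).
  assert (Ey : y = (a j, ezero) [+] (ezero, u' j)) by (unfold y; cbn; f_equal; vec).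
  assert (Em : einner (mu j [-] mu0) (A (a j, ezero)) / s + L j (u' j)
    = / s * einner (mu j [-] nu) (A y)).
  { unfold L. fold s. rewrite Ey, (lin_add _ limit_linear). inner_simpl.
    rewrite !inner_addr, !Enu. unfold Rdiv. ring. }
  rewrite Rplus_assoc, Em, HG0. fold A.
  replace (einner (mu j [-] nu) _ + _) with (einner (mu j [-] nu) (/ (s * s) [*] q j)).
  - unfold vsub. rewrite inner_addl, inner_scall, !inner_scalr, Hmuq.
    specialize (Hnu _ (HKq j)).
    assert (0 < / (s * s)) by (apply Rinv_0_lt_compat; nra). nra.
  - rewrite <- inner_scalr, <- inner_addr. f_equal. vec. field. lra. }
revert M. unfold vsub. rewrite !inner_addl, !inner_addr, !inner_scall, !inner_scalr, !inner_0r. lra.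
Qed.

End Limit.

(** * Stability of the solution map *)

(** [robinson] speaks of distances through the relation [is_dist], so a value must be exhibited
    before it can be used. *)
Lemma is_dist_exists {T} `{EucLaws T} (S : T -> Prop) x : (exists s, S s) -> exists d, is_dist x S d.
Proof.
intros [s0 Hs0].
destruct (completeness (fun r => exists s, S s /\ r = - enorm (x [-] s))) as [m [Hub Hlub]].
- exists 0. intros r [s [_ ->]]. pose proof (enorm_ge0 (x [-] s)). lra.
- now exists (- enorm (x [-] s0)), s0.
- exists (- m). split.
  + intros s Hs. assert (- enorm (x [-] s) <= m) by (apply Hub; now exists s). lra.
  + intros e He. apply NNPP. intros N. assert (m <= m - e); [|lra].
    apply Hlub. intros r [s [Hs ->]]. apply Rnot_lt_le. intros C. apply N. exists s.
    split; [exact Hs|lra].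
Qed.

Lemma is_dist_ge0 {T} `{EucLaws T} (S : T -> Prop) x d : is_dist x S d -> 0 <= d.
Proof.
intros [_ Hd]. apply le_epsilon. intros e He. destruct (Hd e He) as [s [_ Hs]].
pose proof (enorm_ge0 (x [-] s)). lra.
Qed.

Section Product.
Context {P X E : Type} {HP : Euc P} {LP : EucLaws P} {HX : Euc X} {LX : EucLaws X}
  {HE : Euc E} {LE : EucLaws E}.

Lemma linear_inl : linear_map (fun p : P => (p, ezero : X)).
Proof. split; intros; cbn; f_equal; vec. Qed.

Lemma linear_inr : linear_map (fun x : X => (ezero : P, x)).
Proof. split; intros; cbn; f_equal; vec. Qed.

Lemma enorm_inr (x : X) : enorm (ezero : P, x) = enorm x.
Proof. unfold enorm. cbn. now rewrite inner_0l, Rplus_0_l. Qed.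

Lemma pair_addr (p : P) (x y : X) : (p, x) [+] (ezero, y) = (p, x [+] y).
Proof. cbn. f_equal. vec. Qed.

Lemma pair_decomp (p : P) (x : X) : (p, x) = (p, ezero) [+] (ezero, x).
Proof. cbn. f_equal; vec. Qed.

Lemma pair_subr (p : P) (x y : X) : (p, x) [-] (p, y) = (ezero, x [-] y).
Proof. unfold vsub. cbn. f_equal. vec. Qed.

Lemma pair_sub (p q : P) (x y : X) : (p, x) [-] (q, y) = (p [-] q, x [-] y).
Proof. reflexivity. Qed.

Lemma pair_expand (p q : P) (x y : X) s : s <> 0 ->
  (q, y) [+] s [*] (/ s [*] (p [-] q), / s [*] (x [-] y)) = (p, x).
Proof. intros Hs. cbn. f_equal; vec; now field. Qed.

Lemma is_fderiv_partial (G : P * X -> E) p x A :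
  is_fderiv G (p, x) A -> is_fderiv (fun y => G (p, y)) x (fun w => A (ezero, w)).
Proof.
intros [HA HG]. split; [exact (linear_comp _ _ linear_inr HA)|].
intros e He. destruct (HG e He) as [d [Hd H']]. exists d. split; [exact Hd|].
intros w Hw. rewrite <- enorm_inr in Hw |- *. rewrite <- pair_addr. now apply H'.
Qed.

End Product.

(** [fderiv] is a choice, meaningful only where a derivative exists; the first derivatives therefore
    agree only near [z], and the second derivative is taken through [is_fderiv_local]. *)
Lemma fderiv2_inner {T U} `{EucLaws T} `{EucLaws U} (F : T -> U) z d b v w :
  twice_fderiv F (fderiv F) (fderiv2 F z) z d ->
  fderiv2 (fun y => einner b (F y)) z v w = einner b (fderiv2 F z v w).
Proof.
intros [Hd [H1 H2]].
apply (fderiv_eq (fun y => fderiv (fun y => einner b (F y)) y w) z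
  (fun v => einner b (fderiv2 F z v w))).
apply (is_fderiv_local (fun y => einner b (fderiv F y w)) _ z _ d Hd).
- now apply is_fderiv_inner.
- intros y Hy. apply (fderiv_eq (fun y => einner b (F y)) y (fun w => einner b (fderiv F y w))).
  now apply is_fderiv_inner, H1.
Qed.

(** * The constraint system expressed through G = h o g *)

Section System.
Context {n m l k : nat}.
Variables (g : V m * V n -> V l) (C : V l -> Prop) (K : V k -> Prop) (h : V l -> V k)
  (pb : V m) (xb : V n) (dg rho : R).
Let zb := (pb, xb).
Hypotheses (Hdg : 0 < dg) (Hg : C2_on g zb dg) (HK : closed_convex_cone K)
  (Hrho : 0 < rho) (Hh : C2_on h (g zb) rho) (Hh0 : h (g zb) = ezero)
  (Hsurj : forall e : V k, exists y : V l, fderiv h (g zb) y = e)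
  (HCK : forall y, enorm (y [-] g zb) < rho -> (C y <-> K (h y))).

Let G z := h (g z).
Let G' z w := fderiv h (g z) (fderiv g z w).
Let D v w := fderiv2 h (g zb) (fderiv g zb v) (fderiv g zb w) [+] fderiv h (g zb) (fderiv2 g zb v w).

Lemma system_twice_fderiv : exists d, 0 < d /\
  (forall z, enorm (z [-] zb) < d -> enorm (g z [-] g zb) < rho) /\ twice_fderiv G G' D zb d.
Proof.
destruct (twice_fderiv_comp g _ _ h _ _ zb dg rho (C2_twice_fderiv _ _ _ Hdg Hg)
  (C2_twice_fderiv _ _ _ Hrho Hh)) as (d & _ & Hd & HG).
exists d. split; [apply HG|]. now split.
Qed.

Lemma system_g_fderiv : is_fderiv g zb (fderiv g zb).
Proof.
destruct (C2_twice_fderiv _ _ _ Hdg Hg) as (_ & H1 & _).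
apply H1. now rewrite vsub_diag, enorm_0.
Qed.

Lemma system_h_fderiv : is_fderiv h (g zb) (fderiv h (g zb)).
Proof.
destruct (C2_twice_fderiv _ _ _ Hrho Hh) as (_ & H1 & _).
apply H1. now rewrite vsub_diag, enorm_0.
Qed.

Lemma system_fderiv : is_fderiv G zb (G' zb).
Proof. exact (is_fderiv_comp g h zb _ _ system_g_fderiv system_h_fderiv). Qed.

Lemma system_dx_linear : linear_map (dxpart g zb).
Proof. exact (linear_comp _ _ linear_inr (proj1 system_g_fderiv)). Qed.

Lemma system_dp_linear : linear_map (dpart g zb).
Proof. exact (linear_comp _ _ linear_inl (proj1 system_g_fderiv)). Qed.

(** Metric regularity of [h] bounds the distance to [C] by the distance in the reduced space to any
    nearby [q] in [K]; Robinson stability then bounds the distance to the feasible set. The slack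
    [a] is there because [is_dist] is an infimum. *)
Lemma robinson_reduced : robinson g C pb xb -> exists kappa r, 0 <= kappa /\ 0 < r /\
  forall p x q, enorm (p [-] pb) < r -> enorm (x [-] xb) < r -> K q ->
    enorm (G (p, x) [-] q) < r -> forall a, a > 0 ->
    exists y, Gamma g C p y /\ enorm (x [-] y) <= kappa * enorm (G (p, x) [-] q) + a.
Proof.
intros (kappa & Hkappa & rW & rU & HrW & HrU & HR).
destruct (metric_regular h (g zb) rho Hrho (proj1 Hh) Hsurj) as (r & L & Hr & HL & Hreg).
destruct (fderiv_near _ _ _ r system_g_fderiv Hr) as [d [Hd Hnear]].
exists (kappa * L), (Rmin (Rmin rW rU) (Rmin (d / 2) r)).
pose proof (Rmin_l (Rmin rW rU) (Rmin (d / 2) r)). pose proof (Rmin_r (Rmin rW rU) (Rmin (d / 2) r)).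
pose proof (Rmin_l rW rU). pose proof (Rmin_r rW rU).
pose proof (Rmin_l (d / 2) r). pose proof (Rmin_r (d / 2) r).
split; [apply Rmult_le_pos; lra|]. split; [repeat apply Rmin_glb_lt; lra|].
intros p x q Hp Hx Hq Hres a Ha.
assert (Hz : enorm (g (p, x) [-] g zb) < r).
{ apply Hnear. pose proof (enorm_pair (p [-] pb) (x [-] xb)).
  unfold zb. rewrite pair_sub. lra. }
destruct (Hreg (g (p, x)) q Hz) as (y' & E & Hy' & Hd'); [unfold G in Hres; lra|].
assert (HC : C y') by (apply HCK; [exact Hy'|now rewrite E]).
destruct (is_dist_exists C (g (p, x))) as [e He]; [now exists y'|].
destruct (HR p x) with (d := e) as (e' & [_ He'] & Hle); [lra|lra|exact He|].
destruct (He' a Ha) as (y & Hy & Hxy). exists y. split; [exact Hy|].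
assert (e <= L * enorm (G (p, x) [-] q)).
{ destruct He as [He _]. specialize (He y' HC). rewrite enorm_opp in He. unfold G. lra. }
assert (kappa * e <= kappa * (L * enorm (G (p, x) [-] q))) by (apply Rmult_le_compat_l; lra).
lra.
Qed.

Lemma linearized_tangent w : tangent_cone (Gamma g C pb) xb w -> K (G' zb (ezero, w)).
Proof.
intros (t & y & Ht & Ht0 & Hy & HOm). assert (Hnt : null_seq t) by now split.
destruct system_twice_fderiv as (d & Hd & Hnear & _).
pose proof (is_fderiv_partial G pb xb _ system_fderiv) as HF.
pose proof (fderiv_hadamard _ _ _ _ _ _ HF Hnt Hy) as Cq.
refine (eclosed_cv K _ _ (proj1 HK) _ Cq).
generalize (evt_near _ _ _ (null_seq_near xb t y w Hnt Hy) Hd). apply evt_mono. intros j Hj.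
change (G (pb, xb)) with (h (g zb)). rewrite Hh0, vsub_0r. apply HK.
- left. apply Rinv_0_lt_compat, Ht.
- apply HCK; [|apply HOm]. apply Hnear.
  unfold zb. now rewrite pair_subr, enorm_inr.
Qed.

(** Robinson stability at the fixed parameter [pb] moves the points of the ray into the feasible set
    at a cost of o(t). *)
Lemma tangent_linearized w : robinson g C pb xb -> K (G' zb (ezero, w)) ->
  tangent_cone (Gamma g C pb) xb w.
Proof.
intros HR Hw. destruct (robinson_reduced HR) as (kappa & r & Hkap & Hr & HRG).
pose proof (is_fderiv_partial G pb xb _ system_fderiv) as HF.
pose proof null_seq_inv_S as Ht. set (t := fun j => / INR (S j)) in Ht.
assert (R := fderiv_remainder _ _ _ t (fun _ => w) (enorm w) HF Ht
  ltac:(apply evt_all; intros; lra)).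
set (rm := fun j => _) in R. apply (proj1 (cv_enorm0 rm)) in R.
assert (Hrm : forall j, G (pb, xb [+] t j [*] w) [-] t j [*] G' zb (ezero, w) = t j [*] rm j).
{ intros j. unfold rm. change (G (pb, xb)) with (h (g zb)). rewrite Hh0.
  destruct Ht as [Ht _]. specialize (Ht j). vec. field. lra. }
apply (tangent_approx _ xb w t (fun j => kappa * enorm (rm j) + t j) Ht).
2: { replace 0 with (kappa * 0 + 0) by ring.
     apply CV_plus; [apply CV_mult; [apply Un_cv_const|exact R]|apply Ht]. }
assert (R' := CV_mult _ _ _ _ (proj2 Ht) R). rewrite Rmult_0_l in R'.
generalize (evt_and _ _ (evt_near _ _ _ (null_seq_near xb t (fun _ => w) w Ht (cv_const w)) Hr)
  (evt_lt _ _ _ R' Hr)).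
apply evt_mono. intros j [Hj Hj']. destruct Ht as [Ht _]. specialize (Ht j).
cbn beta in Hj'. rewrite Rminus_0_r, Rabs_right in Hj'
  by (apply Rle_ge, Rmult_le_pos; [lra|apply enorm_ge0]).
(* The slack [t j * t j] is itself o(t). *)
destruct (HRG pb (xb [+] t j [*] w) (t j [*] G' zb (ezero, w))) with (a := t j * t j)
  as (y & Hy & Hd).
- now rewrite vsub_diag, enorm_0.
- exact Hj.
- apply HK; [lra|exact Hw].
- rewrite Hrm, enorm_scal, Rabs_right by lra. exact Hj'.
- nra.
- exists y. split; [exact Hy|]. rewrite Hrm, enorm_scal, Rabs_right in Hd by lra.
  rewrite enorm_opp. lra.
Qed.

(** Surjectivity of the derivative of [h] makes its adjoint injective, so the value picked by
    [epsilon] is forced. *)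
Lemma hadj_inv_eq lam mu : (forall w, einner lam w = einner mu (fderiv h (g zb) w)) ->
  hadj_inv h (g zb) lam = mu.
Proof.
intros Hlam. pose proof (proj1 system_h_fderiv) as Hlin.
assert (E : adj (fderiv h (g zb)) (hadj_inv h (g zb) lam) = lam).
{ unfold hadj_inv. apply epsilon_spec. exists mu. apply inner_ext. intros w.
  now rewrite adj_spec. }
apply inner_ext. intros e. destruct (Hsurj e) as [w <-].
now rewrite <- (adj_spec (fderiv h (g zb)) _ w Hlin), E.
Qed.

(** The curvature term of the objective is precisely the contribution of the second derivative of
    [h] to the chain rule for [h o g]. *)
Lemma lam_obj_eq lam mu v : (forall w, einner lam w = einner mu (fderiv h (g zb) w)) ->
  lam_obj g h zb v lam = einner mu (D v v).
Proof.
intros Hlam. unfold lam_obj. rewrite (hadj_inv_eq _ _ Hlam).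
rewrite (fderiv2_inner h (g zb) rho mu) by now apply C2_twice_fderiv.
rewrite Hlam. unfold D. rewrite inner_addr. ring.
Qed.

(** The Hessian terms are defined by coordinates; [adj_spec] restores the bilinear forms, and
    [schwarz] reconciles the order of their arguments with that of [D]. *)
Lemma Fop_eq f lam mu u w : (forall w, einner lam w = einner mu (fderiv h (g zb) w)) ->
  einner (Fop f g h zb lam u) w =
  einner (fderiv f zb (ezero, u)) w + einner mu (D (ezero, u) (ezero, w)).
Proof.
intros Hlam.
destruct (C2_twice_fderiv _ _ _ Hdg Hg) as (_ & Hg1 & Hg2).
destruct (C2_twice_fderiv _ _ _ Hrho Hh) as (_ & Hh1 & Hh2).
unfold Fop. rewrite !inner_addl. unfold dxpart at 1. rewrite Rplus_assoc. f_equal.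
assert (E1 : einner (hessx g zb lam u) w = einner lam (fderiv2 g zb (ezero, w) (ezero, u))).
{ rewrite <- (adj_spec (fun v => fderiv2 g zb (ezero, v) (ezero, u))).
  - f_equal. apply functional_extensionality. intros i. unfold hessx, adj.
    apply (fderiv2_inner g zb dg lam). now apply C2_twice_fderiv.
  - exact (linear_comp _ _ linear_inr (proj1 (Hg2 (ezero, u)))). }
assert (E2 : einner (Hx g h zb lam u) w =
  einner mu (fderiv2 h (g zb) (fderiv g zb (ezero, w)) (fderiv g zb (ezero, u)))).
{ unfold Hx. rewrite (adj_spec _ _ _ system_dx_linear), (hadj_inv_eq _ _ Hlam).
  rewrite <- (adj_spec (fun v => fderiv2 h (g zb) v (fderiv g zb (ezero, u))));
    [|apply Hh2].
  f_equal. apply functional_extensionality. intros i. unfold adj.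
  apply (fderiv2_inner h (g zb) rho mu). now apply C2_twice_fderiv. }
rewrite E1, E2, Hlam.
destruct system_twice_fderiv as (d & _ & _ & HG).
rewrite (schwarz G G' D zb d HG). unfold D. rewrite inner_addr. ring.
Qed.

Lemma perturbed_multiplier (f : V m * V n -> V n) f' :
  robinson g C pb xb -> is_fderiv f zb f' ->
  exists M r, 0 < r /\ forall p x, enorm (p [-] pb) < r -> enorm (x [-] xb) < r ->
    Ssol f g C p x -> forall eps, 0 < eps <= 1 ->
    exists y q mu, enorm (y [-] x) <= eps /\ K q /\ enorm (G (p, y) [-] q) <= eps /\
      (forall e, K e -> einner mu e <= 0) /\ einner mu q = 0 /\ enorm mu <= M /\
      forall w, Rabs (einner (f (p, x)) w + einner mu (G' (p, y) (ezero, w)))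
                <= 2 * eps * enorm w.
Proof.
intros HR Hf. destruct (robinson_reduced HR) as (kappa & r1 & Hkap & Hr1 & HRG).
destruct (fderiv_near _ _ _ 1 Hf Rlt_0_1) as (r2 & Hr2 & Hfb).
destruct system_twice_fderiv as (d & Hd & Hnear & HG).
(* Near [zb] the normal [v = - f (p, x)] has norm at most that of [f zb] plus 1; the other 1 comes
   from [approximate_multiplier]. The bound is thus uniform in [p], [x] and [eps]. The radii are
   halved because the norm of a pair is estimated by the sum of two norms. *)
exists (2 * kappa * (enorm (f zb) + 1 + 1)), (Rmin r1 (Rmin (r2 / 2) (d / 2))).
pose proof (Rmin_l r1 (Rmin (r2 / 2) (d / 2))). pose proof (Rmin_r r1 (Rmin (r2 / 2) (d / 2))).
pose proof (Rmin_l (r2 / 2) (d / 2)). pose proof (Rmin_r (r2 / 2) (d / 2)).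
set (r := Rmin r1 (Rmin (r2 / 2) (d / 2))) in *.
assert (Hr : 0 < r) by (repeat apply Rmin_glb_lt; lra).
split; [exact Hr|]. intros p x Hp Hx (v & Hv & Ev) eps Heps.
assert (Hz : forall y, enorm (y [-] xb) < r -> enorm ((p, y) [-] zb) < 2 * r).
{ intros y Hy. unfold zb. rewrite pair_sub. pose proof (enorm_pair (p [-] pb) (y [-] xb)). lra. }
assert (Efv : forall w, einner v w = - einner (f (p, x)) w).
{ intros w. assert (E : einner (f (p, x) [+] v) w = 0) by (rewrite Ev; apply inner_0l).
  rewrite inner_addl in E. lra. }
assert (Hvn : enorm v <= enorm (f zb) + 1).
{ replace v with ((-1) [*] f (p, x)) by (vec; rewrite Efv; ring).
  rewrite enorm_scal, Rabs_left by lra. specialize (Hz x Hx).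
  assert (B : enorm (f (p, x) [-] f zb) < 1) by (apply Hfb; lra).
  pose proof (enorm_le_add (f (p, x)) (f zb)). lra. }
destruct (approximate_multiplier (Gamma g C p) K (fun y => G (p, y))
  (fun y w => G' (p, y) (ezero, w)) xb r kappa x v eps)
  as (y & q & mu & Q1 & _ & Q2 & Q3 & Q4 & Q5 & Q6 & Q7); auto.
- intros y Hy. apply is_fderiv_partial. destruct HG as (_ & HG & _). apply HG.
  specialize (Hz y Hy). lra.
- intros y q Hy Hq Hres. apply HRG; auto; lra.
- apply HCK; [|apply Hv]. apply Hnear. specialize (Hz x Hx). lra.
- exists y, q, mu. repeat (split; [assumption|]). split.
  + eapply Rle_trans; [exact Q6|]. apply Rmult_le_compat_l; lra.
  + intros w. specialize (Q7 w). rewrite Efv in Q7. rewrite <- Rabs_Ropp.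
    eapply Rle_trans; [|exact Q7]. right. f_equal. ring.
Qed.

(** * The argument by contradiction *)

Lemma holder_stability (f : V m * V n -> V n) :
  C1_around f zb -> Ssol f g C pb xb -> robinson g C pb xb ->
  (forall u : V n, u <> ezero ->
     crit_cone (Gamma g C pb) xb (escal (-1) (f zb)) u ->
     forall lam, Lbar f g C zb lam ->
     forall lh, LamV g h C zb (adjZ g zb lam) (ezero, u) lh ->
       einner (Fop f g h zb lh u) u > 0 \/
       exists ut, crit_cone (Gamma g C pb) xb (escal (-1) (f zb)) ut /\
                  einner (Fop f g h zb lh u) ut < 0) ->
  exists ell rU rQ, ell > 0 /\ rU > 0 /\ rQ > 0 /\
    forall (p : V m) (x : V n),
      enorm (vsub p pb) < rQ -> Ssol f g C p x -> enorm (vsub x xb) < rU ->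
      forall d, is_dist (vsub p pb) (Pset g h K zb) d ->
        enorm (vsub x xb) <= ell * (enorm (vsub p pb) + sqrt d).
Proof.
intros (df & Hdf & HfC1) HS HR HC1. apply NNPP. intros Hneg.
assert (Hf : is_fderiv f zb (fderiv f zb)).
{ apply fderiv_correct, HfC1. now rewrite vsub_diag, enorm_0. }
destruct system_twice_fderiv as (dG & _ & _ & HG).
destruct (perturbed_multiplier f _ HR Hf) as (M & r0 & Hr0 & HM).
assert (Hseq : forall j : nat, exists s : (V m * V n * V n) * (V k * V k * V m),
  let '(p, x, y, (mu, q, b)) := s in
  let t := enorm (x [-] xb) in let i := / INR (S j) in
  0 < t /\ t < i /\ enorm (p [-] pb) <= t * i /\
  Pset g h K zb b /\ enorm (p [-] pb [-] b) <= 2 * (t * t * i) /\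
  enorm (y [-] x) <= t * t * i /\ K q /\ enorm (q [-] G (p, y)) <= t * t * i /\
  (forall e, K e -> einner mu e <= 0) /\ einner mu q = 0 /\ enorm mu <= M /\
  forall w, Rabs (einner (f (p, x)) w + einner mu (G' (p, y) (ezero, w)))
            <= 2 * (t * t * i) * enorm w).
{ intros j. apply NNPP. intros N. apply Hneg.
  pose proof (inv_INR_S_pos j) as Hi.
  assert (Hi1 : / INR (S j) <= 1).
  { pose proof (inv_INR_S_le 0 j ltac:(lia)) as Hle. change (INR 1) with 1 in Hle. rewrite Rinv_1 in Hle. exact Hle. }
  assert (HI : 0 < INR (S j)) by (apply lt_0_INR; lia).
  (* Failure with constant [j + 1] gives both rates at once: the increment of the parameter and the
     root of [d] together stay below [t * i]. *)
  exists (INR (S j)), (Rmin r0 (/ INR (S j))), r0.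
  assert (Hrm : 0 < Rmin r0 (/ INR (S j))) by now apply Rmin_glb_lt.
  split; [lra|]. split; [lra|]. split; [lra|].
  intros p x Hp Hsol Hx d Hdist. apply Rnot_lt_le. intros Hlt. apply N.
  set (i := / INR (S j)) in *. set (t := enorm (x [-] xb)) in *.
  pose proof (Rmin_l r0 i). pose proof (Rmin_r r0 i).
  pose proof (enorm_ge0 (p [-] pb)) as Hp0. pose proof (sqrt_pos d) as Hd0.
  pose proof (is_dist_ge0 _ _ _ Hdist) as Hdpos.
  assert (Hsum : enorm (p [-] pb) + sqrt d < t * i).
  { apply (Rmult_lt_reg_l (INR (S j))); [exact HI|].
    replace (INR (S j) * (t * i)) with t by (unfold i; field; lra). exact Hlt. }
  assert (Ht : 0 < t).
  { apply (Rmult_lt_reg_r i); [exact Hi|]. lra. }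
  assert (Hdle : d <= t * t * i).
  { assert (sqrt d * sqrt d <= (t * i) * (t * i)) by (apply Rmult_le_compat; lra).
    rewrite sqrt_sqrt in * by exact Hdpos.
    assert (t * i * (t * i) <= t * t * i).
    { replace (t * i * (t * i)) with (t * t * i * i) by ring.
      rewrite <- (Rmult_1_r (t * t * i)) at 2. apply Rmult_le_compat_l; nra. }
    lra. }
  assert (Htti : 0 < t * t * i) by (apply Rmult_lt_0_compat; nra).
  (* [d] is at most [t * t * i] and is only an infimum, hence the factor 2 in the estimate for
     [b]. *)
  destruct (proj2 Hdist (t * t * i) Htti) as (b & Hb & Hbd).
  destruct (HM p x Hp (Rlt_le_trans _ _ _ Hx (Rmin_l r0 i)) Hsol (t * t * i)) as (y & q & mu & Q1 & Q2 & Q3 & Q4 & Q5 & Q6 & Q7).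
  { split; [exact Htti|]. assert (t <= 1) by lra. assert (t * t <= 1 * 1) by (apply Rmult_le_compat; lra).
    assert (t * t * i <= 1 * 1) by (apply Rmult_le_compat; nra). lra. }
  exists (p, x, y, (mu, q, b)). cbv beta iota zeta. fold t i.
  rewrite (enorm_opp q). repeat split; auto; lra. }
apply choice in Hseq as [s Hs].
set (pj := fun j => fst (fst (fst (s j)))). set (xj := fun j => snd (fst (fst (s j)))).
set (yj := fun j => snd (fst (s j))). set (mj := fun j => fst (fst (snd (s j)))).
set (qj := fun j => snd (fst (snd (s j)))). set (bj := fun j => snd (snd (s j))).
assert (Hs' : forall j, let t := enorm (xj j [-] xb) in let i := / INR (S j) in
  0 < t /\ t < i /\ enorm (pj j [-] pb) <= t * i /\
  Pset g h K zb (bj j) /\ enorm (pj j [-] pb [-] bj j) <= 2 * (t * t * i) /\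
  enorm (yj j [-] xj j) <= t * t * i /\ K (qj j) /\ enorm (qj j [-] G (pj j, yj j)) <= t * t * i /\
  (forall e, K e -> einner (mj j) e <= 0) /\ einner (mj j) (qj j) = 0 /\ enorm (mj j) <= M /\
  forall w, Rabs (einner (f (pj j, xj j)) w + einner (mj j) (G' (pj j, yj j) (ezero, w)))
            <= 2 * (t * t * i) * enorm w).
{ intros j. generalize (Hs j). unfold pj, xj, yj, mj, qj, bj.
  destruct (s j) as [[[p x] y] [[mu q] b]]. exact (fun H => H). }
clearbody pj xj yj mj qj bj. clear s Hs.
(* Directions and multipliers are extracted together in the product space, so that one subsequence
   serves both. *)
destruct (bolzano_weierstrass
  (fun j => (/ enorm (xj j [-] xb) [*] (xj j [-] xb), mj j)) (1 + M)) as (phi & [u0 mu0] & Hphi & Hlim).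
{ intros j. destruct (Hs' j) as (Ht & _ & _ & _ & _ & _ & _ & _ & _ & _ & Hmj & _).
  eapply Rle_trans; [apply enorm_pair|].
  rewrite enorm_scal, Rabs_right by (left; now apply Rinv_0_lt_compat).
  rewrite Rinv_l by lra. lra. }
pose proof (cv_fst _ _ Hlim) as Hu. pose proof (cv_snd _ _ Hlim) as Hmu. cbn [fst snd] in Hu, Hmu.
set (t := fun j => enorm (xj (phi j) [-] xb)) in *.
set (i := fun j => / INR (S (phi j))).
assert (Hi : Un_cv i 0) by exact (Un_cv_extraction phi _ _ Hphi Un_cv_inv_S).
assert (Hip : forall j, 0 < i j) by (intros j; apply inv_INR_S_pos).
assert (Htp : forall j, 0 < t j) by (intros j; apply (Hs' (phi j))).
assert (Ht : null_seq t).
{ split; [exact Htp|]. apply (Un_cv_squeeze _ i); [|exact Hi]. apply evt_all. intros j.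
  rewrite Rabs_right by (apply Rle_ge; left; apply Htp). left. apply (Hs' (phi j)). }
assert (Hit : forall j, 0 < / t j) by (intros j; now apply Rinv_0_lt_compat).
set (a := fun j => / t j [*] (pj (phi j) [-] pb)).
set (u := fun j => / t j [*] (xj (phi j) [-] xb)) in *.
set (u' := fun j => / t j [*] (yj (phi j) [-] xb)).
set (mu := fun j => mj (phi j)) in *. set (q := fun j => qj (phi j)).
set (r := fun j => pj (phi j) [-] pb [-] bj (phi j)).
change (cv u u0) in Hu.
assert (Hu1 : enorm u0 = 1).
{ eapply UL_sequence; [exact (cv_enorm _ _ Hu)|].
  apply (Un_cv_evt_eq (fun _ => 1)); [|apply Un_cv_const]. apply evt_all. intros j.
  specialize (Htp j). specialize (Hit j). unfold u. rewrite enorm_scal, Rabs_right by lra.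
  fold (t j). field. lra. }
assert (Ezx : forall j, zb [+] t j [*] (a j, u j) = (pj (phi j), xj (phi j))).
{ intros j. apply pair_expand. specialize (Htp j). lra. }
assert (Ezy : forall j, zb [+] t j [*] (a j, u' j) = (pj (phi j), yj (phi j))).
{ intros j. apply pair_expand. specialize (Htp j). lra. }
assert (Ha : cv a ezero).
{ apply (cv_squeeze _ i); [|exact Hi]. apply evt_all. intros j. unfold a.
  specialize (Htp j). specialize (Hit j).
  destruct (Hs' (phi j)) as (_ & _ & Hp & _). fold (t j) (i j) in Hp.
  rewrite enorm_scal, Rabs_right by lra.
  apply (Rmult_le_reg_l (t j)); [exact Htp|]. rewrite <- Rmult_assoc, Rinv_r; lra. }
assert (Hti : Un_cv (fun j => t j * i j) 0).
{ replace 0 with (0 * 0) by ring. apply CV_mult; [apply Ht|exact Hi]. }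
assert (Hu' : cv u' u0).
{ apply (cv_eq (fun j => u j [+] / t j [*] (yj (phi j) [-] xj (phi j))) _ (u0 [+] ezero)).
  - intros j. unfold u, u'. vec.
  - vec.
  - apply cv_add; [exact Hu|]. apply (cv_squeeze _ (fun j => t j * i j)); [|exact Hti].
    apply evt_all. intros j. specialize (Htp j). specialize (Hit j).
    destruct (Hs' (phi j)) as (_ & _ & _ & _ & _ & Hy & _). fold (t j) (i j) in Hy.
    rewrite enorm_scal, Rabs_right by lra.
    apply (Rmult_le_reg_l (t j)); [exact Htp|]. rewrite <- Rmult_assoc, Rinv_r; lra. }
assert (Hpol : forall j e, K e -> einner (mu j) e <= 0).
{ intros j. now destruct (Hs' (phi j)) as (_ & _ & _ & _ & _ & _ & _ & _ & Hj & _). }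
assert (HKq : forall j, K (q j)).
{ intros j. now destruct (Hs' (phi j)) as (_ & _ & _ & _ & _ & _ & Hj & _). }
assert (Hmuq : forall j, einner (mu j) (q j) = 0).
{ intros j. now destruct (Hs' (phi j)) as (_ & _ & _ & _ & _ & _ & _ & _ & _ & Hj & _). }
assert (Hscale : forall (E : Type) (HE : Euc E) (LE : EucLaws E) (e : nat -> E) c,
  (forall j, enorm (e j) <= c * (t j * t j * i j)) -> cv (fun j => / (t j * t j) [*] e j) ezero).
{ intros E HE LE e c He. apply (cv_squeeze _ (fun j => c * i j)).
  - apply evt_all. intros j. specialize (Htp j). specialize (He j).
    assert (Htt : 0 < t j * t j) by nra.
    rewrite enorm_scal, Rabs_right by (left; now apply Rinv_0_lt_compat).
    apply (Rmult_le_reg_l (t j * t j)); [exact Htt|]. rewrite <- Rmult_assoc, Rinv_r; lra.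
  - replace 0 with (c * 0) by ring. apply CV_mult; [apply Un_cv_const|exact Hi]. }
assert (Hq : cv (fun j => / (t j * t j) [*] (q j [-] G (zb [+] t j [*] (a j, u' j)))) ezero).
{ apply (Hscale _ _ _ _ 1). intros j. rewrite Ezy, Rmult_1_l.
  now destruct (Hs' (phi j)) as (_ & _ & _ & _ & _ & _ & _ & Hj & _). }
assert (Hr : cv (fun j => / (t j * t j) [*] r j) ezero).
{ apply (Hscale _ _ _ _ 2). intros j.
  now destruct (Hs' (phi j)) as (_ & _ & _ & _ & Hj & _). }
assert (Hstat : forall w, Un_cv (fun j => (einner (f (zb [+] t j [*] (a j, u j))) w +
  einner (mu j) (G' (zb [+] t j [*] (a j, u' j)) (ezero, w))) / t j) 0).
{ intros w. apply (Un_cv_squeeze _ (fun j => t j * i j * (2 * enorm w))).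
  - apply evt_all. intros j. rewrite Ezx, Ezy. specialize (Htp j). specialize (Hit j).
    destruct (Hs' (phi j)) as (_ & _ & _ & _ & _ & _ & _ & _ & _ & _ & _ & Hj).
    specialize (Hj w). fold (t j) (i j) (mu j) in Hj. unfold Rdiv.
    rewrite Rabs_mult, (Rabs_right (/ t j)) by lra.
    apply (Rmult_le_reg_r (t j)); [exact Htp|]. rewrite Rmult_assoc, Rinv_l by lra. lra.
  - replace 0 with (0 * (2 * enorm w)) by ring. apply CV_mult; [exact Hti|apply Un_cv_const]. }
assert (Hsplit : forall j, t j [*] a j = bj (phi j) [+] r j).
{ intros j. unfold a, r. specialize (Htp j). vec. field. lra. }
assert (Hb : forall j, exists v w, linK K w /\
  G' zb (bj (phi j), ezero) = G' zb (ezero, v) [+] w).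
{ intros j. destruct (Hs' (phi j)) as (_ & _ & _ & (v & w & Hw & E) & _). exists v, w.
  split; [exact Hw|]. unfold dpart, dxpart in E.
  now rewrite !(fderiv_eq _ _ _ _ system_fderiv) in E. }
clearbody t i a u u' mu q r. clear Hs' Ezx Ezy Hscale.
assert (Hpol0 := limit_polar K mu mu0 Hmu Hpol).
assert (Hst0 := limit_stationary G G' D f _ zb dG HG Hf t a u u' u0 mu mu0 Ht Ha Hu Hu' Hmu Hstat).
assert (Hcr := limit_critical G G' D zb dG K HG Hh0 HK t a u' u0 mu q mu0 Ht Ha Hu' Hmu HKq Hmuq Hq).
assert (Hge0 := limit_Phi_ge0 G G' D f _ zb dG K HG Hf t a u u' u0 mu mu0 Ht Ha Hu Hu' Hmu Hpol Hstat).
assert (Hmax := limit_maximal G G' D f _ zb dG K HG Hh0 Hf HK t a (fun j => bj (phi j)) r u u' u0 mu q mu0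
  Ht Ha Hu Hu' Hmu Hpol HKq Hmuq Hq Hstat Hsplit Hb Hr).
cbv beta zeta in Hst0, Hcr, Hge0, Hmax.
set (lam := adj (fderiv h (g zb)) mu0).
assert (Hlam : forall w, einner lam w = einner mu0 (fderiv h (g zb) w)).
{ intros w. apply adj_spec, system_h_fderiv. }
assert (Hlamx : forall w, einner (adj (dxpart g zb) lam) w = einner mu0 (G' zb (ezero, w))).
{ intros w. rewrite (adj_spec _ _ _ system_dx_linear). apply Hlam. }
assert (HlamN : rnormal C (g zb) lam).
{ exact (reduction_normal C K h (g zb) rho Hrho (proj1 Hh) Hh0 HCK HK lam mu0 Hpol0 Hlam). }
(* With [nu = mu0] the bound gives Phi(u0) <= 0. Once Phi(u0) >= 0 is known, the same bound for
   general [nu] says that [mu0] is a maximiser. *)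
assert (HPhi0 := Hmax mu0 Hpol0 (fun v => eq_refl)).
destruct Hcr as [HKu Hmu0u].
assert (HPhi1 := Hge0 u0 HKu Hmu0u).
(* The limit multiplier plays both roles in (C1): it is the base multiplier and the maximiser over
   the multipliers sharing its image under the adjoint of the derivative of [g]. *)
destruct (HC1 u0) with (lam := lam) (lh := lam) as [Hpos|(ut & [Hut Hfut] & Hneg')].
- intros ->. rewrite enorm_0 in Hu1. lra.
- split; [now apply tangent_linearized|]. rewrite inner_scall. specialize (Hst0 u0). lra.
- split; [exact HlamN|]. apply inner_ext. intros w.
  rewrite inner_addl, inner_0l, Hlamx. apply Hst0.
- split; [split; [exact HlamN|reflexivity]|]. intros lam' [HlamN' Eadj].
  destruct (normal_reduction C K h (g zb) rho Hrho (proj1 Hh) Hh0 Hsurj HCK HK lam' HlamN')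
    as (nu & Hnu & Enu).
  rewrite (lam_obj_eq lam' nu _ Enu), (lam_obj_eq lam mu0 _ Hlam).
  assert (EA : forall v, einner nu (G' zb v) = einner mu0 (G' zb v)).
  { intros [p x]. unfold G'. rewrite <- Enu, <- Hlam.
    rewrite pair_decomp, (lin_add _ (proj1 system_g_fderiv)), !inner_addr.
    change (fderiv g zb (p, ezero)) with (dpart g zb p).
    change (fderiv g zb (ezero, x)) with (dxpart g zb x).
    rewrite <- !(adj_spec _ _ _ system_dp_linear), <- !(adj_spec _ _ _ system_dx_linear).
    unfold adjZ in Eadj. injection Eadj as -> ->. reflexivity. }
  specialize (Hmax nu Hnu EA). lra.
- rewrite (Fop_eq f lam mu0 _ _ Hlam) in Hpos. lra.
- rewrite (Fop_eq f lam mu0 _ _ Hlam) in Hneg'.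
  rewrite inner_scall in Hfut.
  assert (E : einner mu0 (G' zb (ezero, ut)) = 0) by (specialize (Hst0 ut); lra).
  specialize (Hge0 ut (linearized_tangent ut Hut) E). lra.
Qed.

End System.

Theorem theorem6p1 (n m l k : nat)
  (g : V m * V n -> V l) (f : V m * V n -> V n)
  (C : V l -> Prop) (K : V k -> Prop) (h : V l -> V k)
  (pb : V m) (xb : V n) :
  (* g is C^2 and f is C^1 around zb = (pb,xb) *)
  C2_around g (pb, xb) ->
  C1_around f (pb, xb) ->
  (* C closed and C^2-cone reducible at g(zb) to the closed convex cone K via h *)
  eclosed_set C ->
  closed_convex_cone K ->
  (exists rho, rho > 0 /\ C2_on h (g (pb, xb)) rho /\
     h (g (pb, xb)) = ezero /\
     (forall e : V k, exists y : V l, fderiv h (g (pb, xb)) y = e) /\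
     (forall y, enorm (vsub y (g (pb, xb))) < rho -> (C y <-> K (h y)))) ->
  (* xb in S(pb) *)
  Ssol f g C pb xb ->
  (* Robinson stability *)
  robinson g C pb xb ->
  (* condition (C1) *)
  (forall u : V n, u <> ezero ->
     crit_cone (Gamma g C pb) xb (escal (-1) (f (pb, xb))) u ->
     forall lam, Lbar f g C (pb, xb) lam ->
     forall lh, LamV g h C (pb, xb) (adjZ g (pb, xb) lam) (ezero, u) lh ->
       einner (Fop f g h (pb, xb) lh u) u > 0 \/
       exists ut, crit_cone (Gamma g C pb) xb (escal (-1) (f (pb, xb))) ut /\
                  einner (Fop f g h (pb, xb) lh u) ut < 0) ->
  exists ell rU rQ, ell > 0 /\ rU > 0 /\ rQ > 0 /\
    forall (p : V m) (x : V n),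
      enorm (vsub p pb) < rQ -> Ssol f g C p x -> enorm (vsub x xb) < rU ->
      forall d, is_dist (vsub p pb) (Pset g h K (pb, xb)) d ->
        enorm (vsub x xb) <= ell * (enorm (vsub p pb) + sqrt d).
Proof.
intros (dg & Hdg & Hg) Hf _ HK (rho & Hrho & Hh & Hh0 & Hsurj & HCK) HS HR HC1.
exact (holder_stability g C K h pb xb dg rho Hdg Hg HK Hrho Hh Hh0 Hsurj HCK f Hf HS HR HC1).
Qed.
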